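(* Let $O\subseteq X$ be an open set, let $f\in L(\log L)^{1/2}(O,\gamma)$ and let $h\in QX^*$. Then $$V_\gamma^{h}(f,O)=\int_{K}V^h_{\gamma_1}(f_y,O_y^h)\,\gamma^\perp_h(dy).$$
   Context: Wiener space. $X$ is a separable Banach space with dual $X^*$ and duality $\langle\cdot,\cdot\rangle$; $\gamma$ is a nondegenerate centred Gaussian measure on $X$ with covariance operator $Q\in\mathcal L(X^*,X)$, i.e. $\int_X e^{i\langle x,x^*\rangle}\gamma(dx)=\exp(-\frac12\langle Qx^*,x^*\rangle)$, and $\langle Qx^*,x^*\rangle>0$ for $x^*\neq0$. For $h\in QX^*$ there is a unique $x^*\in X^*$ with $h=Qx^*$, and we write $\hat h(x)=\langle x,x^*\rangle$, so that $\hat h\in X^*$. Orlicz space. $A_{1/2}(x)=\int_0^x(\ln(1+t))^{1/2}dt$ for $x\ge0$, and $L(\log L)^{1/2}(O,\gamma)=\{f\in L^1(O,\gamma): A_{1/2}(|f|)\in L^1(O,\gamma)\}$. Test functions. For an open subset $\Omega$ of $X$ (resp. of $\mathbb R$), ${\rm Lip}_c(\Omega)$ is the set of bounded Lipschitz real functions on $X$ (resp. on $\mathbb R$) whose support is a bounded subset of $\Omega$ with positive distance from the complement of $\Omega$. For $G\in{\rm Lip}_c(O)$, $\partial_hG(x)=\lim_{t\to0}(G(x+th)-G(x))/t$ (existing $\gamma$-a.e.) and $\partial_h^*G=\partial_hG-G\hat h$. Variation along $h$. $V_\gamma^h(f,O)=\sup\{\int_Of\,\partial_h^*G\,d\gamma:\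 G\in{\rm Lip}_c(O),\ |G(x)|\le1\ \forall x\in O\}\in[0,+\infty]$. Sections. $K=\ker\hat h$; $\pi_h:X\to{\rm span}\{h\}$ is the projection on ${\rm span}\{h\}$ (with kernel $K$); $\gamma$ is decomposed as $\gamma=\gamma_1\otimes\gamma_h^\perp$, where $\gamma_1=\gamma\circ\pi_h^{-1}$, regarded as a measure in the real variable $t$ through $th\leftrightarrow t$, and $\gamma_h^\perp=\gamma\circ(I-\pi_h)^{-1}$, which is concentrated on $K$. For $y\in K$, $O_y^h=\{t\in\mathbb R: y+th\in O\}$ and $f_y(t)=f(y+th)$ for $t\in O_y^h$. Finally, $$V^h_{\gamma_1}(f_y,O_y^h)=\sup\Big\{\int_{O_y^h}f_y(t)(\psi'(t)-t\psi(t))\,d\gamma_1(t):\ \psi\in{\rm Lip}_c(O_y^h),\ |\psi(t)|\le1\ \forall t\in O_y^h\Big\},$$ where $\psi'(t)-t\psi(t)$ is the Gaussian divergence of $\psi$ in dimension $1$.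
   Formalization: It is assumed that h is nonzero (otherwise th↔t is undefined), and the one-dimensional divergence is taken with respect to the actual law γ_1 = N(0,1/ĥ(h)): ψ'(t) − ĥ(h)tψ(t), which equals ψ'(t) − tψ(t) exactly when ĥ(h)=1; the literal formula fails for other h (f=1, O=X). *)

(* Defs.v *)
From HB Require Import structures.
From mathcomp Require Import all_boot all_order all_algebra.
From mathcomp Require Import all_classical all_reals all_analysis.
From mathcomp Require complex.
Set Implicit Arguments.
Unset Strict Implicit.
Unset Printing Implicit Defensive.
Import Order.TTheory GRing.Theory Num.Theory.
Import numFieldTopology.Exports numFieldNormedType.Exports.
Local Open Scope classical_set_scope.
Local Open Scope ring_scope.

Definition separable_space (T : topologicalType) : Prop :=
  exists S : set T, countable S /\ dense S.

Notation borel X := (g_sigma_algebraType (@open X)).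

Definition clinear (R : realType) (X : normedModType R) : {pred X -> R^o} :=
  fun l => `[< linear l /\ continuous l >].
Arguments clinear {R} X.

Lemma clinear_submod_closed (R : realType) (X : normedModType R) :
  submod_closed (clinear X).
Proof.
split=> [|a l m /asboolP[ll cl] /asboolP[lm cm]]; apply/asboolP; split.
- by move=> a x y; rewrite /= scaler0 addr0.
- by move=> x; exact: cst_continuous.
- move=> b x y; rewrite !fctE ll lm !scalerDr !scalerA [b * a]mulrC -!addrA.
  by congr (_ + _); rewrite addrCA.
- by move=> x; apply: continuousD; [apply: continuousZl_tmp; exact: cl | exact: cm].
Qed.

HB.instance Definition _ (R : realType) (X : normedModType R) :=
  GRing.isSubmodClosed.Build R (X -> R^o) (clinear X)
    (clinear_submod_closed X).

Record dual (R : realType) (X : normedModType R) := Dual {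
  dual_fun :> X -> R^o;
  _ : dual_fun \in clinear X }.

HB.instance Definition _ (R : realType) (X : normedModType R) :=
  [isSub of dual X for @dual_fun R X].
HB.instance Definition _ (R : realType) (X : normedModType R) :=
  [Choice of dual X by <:].
HB.instance Definition _ (R : realType) (X : normedModType R) :=
  [SubChoice_isSubLmodule of dual X by <:].

Definition dual_norm (R : realType) (X : normedModType R) (l : dual X) : R :=
  sup [set `|l x| | x in [set x : X | `|x| <= 1]].

Section gaussian.
Context (R : realType) (X : normedModType R).
Implicit Types (gamma : probability (borel X) R) (Q : {linear dual X -> X}).

(* The real and imaginary parts of the integral of e^{i <x, l>}. *)
Definition charfun gamma (l : dual X) : complex.complex R :=
  complex.Complex (\int[gamma]_x cos (l x))%R (\int[gamma]_x sin (l x))%R.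

(* Symmetry is part of the notion of covariance operator; the characteristic
   function alone only determines the quadratic form l (Q l). *)
Definition centred_gaussian gamma Q : Prop :=
  [/\ exists C : R, forall l : dual X, `|Q l| <= C * dual_norm l,
      forall l m : dual X, m (Q l) = l (Q m) &
      forall l : dual X,
        charfun gamma l = complex.Complex (expR (- (2^-1 * l (Q l)))) 0].

Definition nondegenerate_cov Q : Prop := forall l : dual X, l != 0 -> 0 < l (Q l).

End gaussian.

Section orlicz.
Context (R : realType).

Definition A_half (x : R) : R :=
  (\int[lebesgue_measure]_(t in `[0, x]) powR (ln (1 + t)) (2^-1))%R.

Definition L_logL_half d (T : measurableType d) (mu : {measure set T -> \bar R})
    (O : set T) (f : T -> R) : Prop :=
  mu.-integrable O (EFin \o f) /\
  mu.-integrable O (fun x => (A_half `|f x|)%:E).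

End orlicz.

Definition lip_c (R : realType) (V : normedModType R) (Om : set V) :
    set (V -> R^o) :=
  [set G | let S := closure [set x | G x != 0] in
    [/\ bounded_fun G, lipschitz G, bounded_set S, S `<=` Om &
        exists2 d : R, 0 < d & forall x y, S x -> ~ Om y -> d <= `|x - y|]].

Section variation.
Context (R : realType) (X : normedModType R).
Variable gamma : probability (borel X) R.

(* The functional hh stands for the hat of h, i.e. h = Q hh. *)
Definition dstar (h : X) (hh : dual X) (G : X -> R^o) (x : X) : R :=
  'D_h G x - G x * hh x.

Definition Vgamma (h : X) (hh : dual X) (f : X -> R) (O : set X) : \bar R :=
  ereal_sup [set (\int[gamma]_(x in O) (f x * dstar h hh G x)%:E)%E
    | G in [set G | lip_c O G /\ forall x, O x -> `|G x| <= 1]].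

Definition proj_h (h : X) (hh : dual X) (x : X) : X := (hh x / hh h) *: h.

(* The law of proj_h under gamma, read in the real variable t with
   proj_h x = t *: h. For h = Q hh it is centred Gaussian of variance
   (hh h)^-1, hh h being the squared Cameron-Martin norm of h. *)
Definition gamma1 (h : X) (hh : dual X) : set R -> \bar R :=
  pushforward gamma (fun x : borel X => hh x / hh h : R).

Definition gamma_perp (h : X) (hh : dual X) : set (borel X) -> \bar R :=
  pushforward gamma (fun x : borel X => x - proj_h h hh x : borel X).

End variation.

Definition section_set (R : realType) (X : normedModType R) (O : set X)
    (h y : X) : set R := [set t | O (y + t *: h)].

Definition section_fun (R : realType) (X : normedModType R) (f : X -> R)
    (h y : X) : R -> R := fun t => f (y + t *: h).

Section variation1.
Context (R : realType).

(* The divergence with respect to the centred Gaussian law of variance v: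
   - gauss_div1 v is the formal adjoint of d/dt in L^2 of that law. *)
Definition gauss_div1 (v : R) (psi : R -> R^o) (t : R) : R :=
  derive1 psi t - t / v * psi t.

Lemma gauss_div1_standard (psi : R -> R^o) (t : R) :
  gauss_div1 1 psi t = derive1 psi t - t * psi t.
Proof. by rewrite /gauss_div1 divr1. Qed.

Definition Vgamma1 (mu : set R -> \bar R) (v : R) (g : R -> R) (U : set R) :
    \bar R :=
  ereal_sup [set (\int[mu]_(t in U) (g t * gauss_div1 v psi t)%:E)%E
    | psi in [set psi | lip_c U psi /\ forall t, U t -> `|psi t| <= 1]].

End variation1.

(* Main.v *)
Require Import Defs.
From HB Require Import structures.
From mathcomp Require Import all_boot all_order all_algebra.
From mathcomp Require Import all_classical all_reals all_analysis.
From mathcomp Require Import measurable_realfun.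
From mathcomp Require Import ring lra zify.

(** Write x = y + t h with y in the kernel K of hh. The characteristic function of gamma splits along
    this decomposition, because x - proj_h x and hh x are uncorrelated, so by uniqueness of
    characteristic functions ([charfun_unique]) gamma is the image of the product of the laws of t and
    y ([gaussian_decomposition]), and integrals over X are iterated integrals over lines parallel to h
    ([gaussian_fubini]). Along such a line the divergence of a test function G is the one-dimensional
    Gaussian divergence of its section. Sections of admissible test functions are admissible, which
    gives one inequality ([variation_le_sections]).

    For the other inequality, nearly optimal test functions on the lines have to be glued into one
    Lipschitz function of x. Test functions on a line are first discretised: a Lipschitz psi is
    replaced by its piecewise linear interpolant on a mesh, a combination of tents with
    coefficients psi (node). The divergences of the interpolants converge almost everywhere to that of
    psi, since Lipschitz functions are almost everywhere differentiable ([derivable_lipschitz]) and the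
    law of t is absolutely continuous ([gaussian_charfun_dominates]). For a fixed mesh, the best choice of
    coefficients on the line through y is explicit: the sign of the pairing [coeff] of f with the divergence
    of each tent that fits inside O, of value [sections_sum]. Hence the variation of almost every
    section is at most the lower limit of these sums ([Vgamma1_le_liminf]). The signs are measurable
    functions of y and can be approximated in L^1 by Lipschitz cutoffs ([cutoff_approx]); multiplying
    these with the tents yields admissible test functions on X, so the integral of each sum is at most
    the variation of f ([sections_sum_le_variation]). Fatou's lemma concludes
    ([sections_le_variation]).

    The sectional variation, a supremum of an uncountable family, is not known to be measurable in y. Its
    integral is the supremum over simple functions below it, which is monotone
    ([ge0_le_lower_integral]); both inequalities compare it with measurable functions only. *)

Set Implicit Arguments.
Unset Strict Implicit.
Unset Printing Implicit Defensive.
Import Order.TTheory GRing.Theory Num.Theory.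
Import numFieldTopology.Exports numFieldNormedType.Exports.
Local Open Scope classical_set_scope.
Local Open Scope ring_scope.

(** * Continuous functionals and the Hahn-Banach theorem *)

Section dualtheory.
Context (R : realType) (X : normedModType R).
Implicit Types (l m : dual X) (x y : X) (a : R).

Lemma dual_in l : (l : X -> R^o) \in clinear X.
Proof. by case: l. Qed.

Lemma dual_continuous l : continuous l.
Proof. by have /asboolP[] := dual_in l. Qed.

Lemma dual_linear l : linear l.
Proof. by have /asboolP[] := dual_in l. Qed.

HB.instance Definition _ l := GRing.isLinear.Build R X R^o _ l (dual_linear l).

Lemma dualDE l m x : (l + m) x = l x + m x. Proof. by []. Qed.
Lemma dualZE a l x : (a *: l) x = a * l x. Proof. by []. Qed.
Lemma dual0E x : (0 : dual X) x = 0. Proof. by []. Qed.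
Lemma dualBE l m x : (l - m) x = l x - m x. Proof. by []. Qed.
Lemma dualZr l a x : l (a *: x) = a * l x. Proof. exact: linearZ. Qed.

Lemma dualDr l x y : l (x + y) = l x + l y. Proof. exact: linearD. Qed.
Lemma dualBr l x y : l (x - y) = l x - l y. Proof. exact: linearB. Qed.

End dualtheory.

Section hahn_banach.
Context (R : realType) (X : normedModType R).
Implicit Types (p q : X -> R).

(** The bound by the norm makes such functionals automatically continuous. *)
Definition sublin p := [/\ forall x y, p (x + y) <= p x + p y,
  forall (t : R) x, 0 < t -> p (t *: x) = t * p x & forall x, p x <= `|x|].

Lemma sublin0 p : sublin p -> p 0 = 0.
Proof.
move=> [_ pZ _]; have := pZ 2 0 (ltr0Sn _ _).
by rewrite scaler0 => /eqP; rewrite -subr_eq0 => /eqP; lra.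
Qed.

Lemma sublin_ge p : sublin p -> forall x, - `|x| <= p x.
Proof.
move=> sp x; have p0 := sublin0 sp; case: sp => pD _ pn.
have := pD x (- x); rewrite subrr p0; have := pn (- x); rewrite normrN; lra.
Qed.

(** The value of p at x after moving x along z at the linear price t * p z. It lies below p and
    satisfies pull p z (- z) <= - p z, so a functional that cannot be lowered this way is odd along z. *)
Definition pull p z x := inf [set p (x + t *: z) - t * p z | t in [set t | 0 <= t]].

Lemma pull_le p z x t : sublin p -> 0 <= t ->
  pull p z x <= p (x + t *: z) - t * p z.
Proof.
move=> sp t0; apply: ge_inf; last by exists t.
exists (- p (- x)) => _ [u /= u0 <-].
have [pD pZ _] := sp; have := pD (x + u *: z) (- x).
rewrite addrAC subrr add0r.
have [->|u1] := eqVneq u 0; first by rewrite !scale0r mul0r addr0 sublin0//; lra.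
by rewrite pZ ?lt_neqAle 1?eq_sym ?u1//; lra.
Qed.

Lemma pull_ge p z x c : sublin p ->
  (forall t, 0 <= t -> c <= p (x + t *: z) - t * p z) -> c <= pull p z x.
Proof.
move=> sp h; apply: lb_le_inf; first by exists (p (x + 0 *: z) - 0 * p z), 0 => /=.
by move=> _ [t /= t0 <-]; exact: h.
Qed.

Lemma pull_sublin p z : sublin p -> sublin (pull p z).
Proof.
move=> sp; have [pD pZ pn] := sp.
have hZ (t : R) x : 0 < t -> pull p z (t *: x) <= t * pull p z x.
  move=> t0; rewrite mulrC -ler_pdivrMr//; apply: pull_ge => // s s0.
  rewrite ler_pdivrMr// mulrC.
  have /(pull_le z (t *: x) sp) : 0 <= t * s by rewrite mulr_ge0// ltW.
  by rewrite -scalerA -scalerDr pZ// mulrBr mulrA.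
split.
- move=> x y; rewrite -lerBlDr; apply: pull_ge => // s s0.
  rewrite lerBlDr -lerBlDl; apply: pull_ge => // t t0.
  rewrite lerBlDr.
  have /(pull_le z (x + y) sp) : 0 <= t + s by rewrite addr_ge0.
  have := pD (x + s *: z) (y + t *: z).
  have -> : x + s *: z + (y + t *: z) = x + y + (t + s) *: z.
    by rewrite scalerDl addrACA [s *: z + _]addrC.
  by lra.
- move=> t x t0; apply/eqP; rewrite eq_le hZ//=.
  have ti : 0 < t^-1 by rewrite invr_gt0.
  have := hZ t^-1 (t *: x) ti; rewrite scalerA mulVf ?gt_eqF// scale1r.
  by rewrite mulrC ler_pdivlMr// mulrC.
- move=> x; apply: le_trans (pn x).
  by have := pull_le z x sp (lexx 0); rewrite scale0r mul0r addr0 subr0.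
Qed.

Lemma norm_sublin : sublin (fun x => `|x|).
Proof.
split => [x y|t x t0|x] //; first exact: ler_normD.
by rewrite normrZ gtr0_norm.
Qed.

(** By Zorn's lemma: the bound - |x| <= p x makes pointwise infima along a chain finite, and
    comparability within the chain keeps the infimum subadditive. *)
Lemma min_sublin p0 : sublin p0 -> exists p, [/\ sublin p, forall x, p x <= p0 x &
  forall q, sublin q -> (forall x, q x <= p x) -> q = p].
Proof.
move=> sp0.
pose T := {p : X -> R | sublin p /\ forall x, p x <= p0 x}.
pose r (p q : T) := `[< forall x, sval q x <= sval p x >].
have [|||F tF|[p [sp pp0]] pmin] := @Zorn T r.
- by move=> t; apply/asboolP.
- move=> p q s /asboolP pq /asboolP qs; apply/asboolP => x.
  exact: le_trans (qs x) (pq x).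
- move=> p q /asboolP pq /asboolP qp; apply: eq_sig_hprop; first by move=> *; exact: Prop_irrelevance.
  apply/funext => x.
  by apply/eqP; rewrite eq_le pq qp.
- have [->|/set0P F0] := eqVneq F set0.
    by exists (exist _ p0 (conj sp0 (fun x => lexx _))).
  pose E x := [set sval p x | p in F].
  have E0 x : E x !=set0 by case: F0 => p Fp; exists (sval p x), p.
  have lE (p : T) x : F p -> inf (E x) <= sval p x.
    move=> Fp; apply: ge_inf; last by exists p.
    by exists (- `|x|) => _ [q Fq <-]; apply: sublin_ge; case: (svalP q).
  have gE x c : (forall p : T, F p -> c <= sval p x) -> c <= inf (E x).
    by move=> h; apply: lb_le_inf => // _ [q Fq <-]; exact: h.
  have hZ (t : R) x : 0 < t -> inf (E (t *: x)) <= t * inf (E x).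
    move=> t0; rewrite mulrC -ler_pdivrMr//; apply: (gE) => p Fp.
    rewrite ler_pdivrMr// mulrC; have := lE p (t *: x) Fp.
    by have [[_ -> //]] := svalP p.
  have sE : sublin (fun x => inf (E x)) /\ forall x, inf (E x) <= p0 x.
    split; last first.
      by move=> x; case: F0 => p Fp; rewrite (le_trans (lE p x Fp))//; case: (svalP p).
    split.
    + move=> x y; rewrite -lerBlDr; apply: (gE) => p Fp.
      rewrite lerBlDr -lerBlDl; apply: (gE) => q Fq.
      rewrite lerBlDr.
      have [[pD _ _] _] := svalP p; have [[qD _ _] _] := svalP q.
      have [h|h] := tF p q Fp Fq; move: h => /asboolP h.
        have := lE q (x + y) Fq; have := qD x y; have := h x; have := h y; lra.
      have := lE p (x + y) Fp; have := pD x y; have := h x; have := h y; lra.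
    + move=> t x t0; apply/eqP; rewrite eq_le hZ//=.
      have ti : 0 < t^-1 by rewrite invr_gt0.
      have := hZ t^-1 (t *: x) ti; rewrite scalerA mulVf ?gt_eqF// scale1r.
      by rewrite mulrC ler_pdivlMr// mulrC.
    + move=> x; case: F0 => p Fp; rewrite (le_trans (lE p x Fp))//.
      by case: (svalP p) => -[].
  exists (exist (fun p => sublin p /\ forall x, p x <= p0 x) _ sE) => p Fp; apply/asboolP => x /=; exact: lE.
- exists p; split => // q sq qp.
  have sq' : sublin q /\ forall x, q x <= p0 x.
    by split => // x; exact: le_trans (qp x) (pp0 x).
  have /pmin : r (exist _ p (conj sp pp0)) (exist _ q sq') by apply/asboolP.
  by move=> [].
Qed.

(** Minimality forces pull p z = p for every z, which at t = 1 reads p x <= p (x + z) - p z, the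
    inequality missing from subadditivity. *)
Lemma min_sublin_linear p : sublin p ->
  (forall q, sublin q -> (forall x, q x <= p x) -> q = p) ->
  (forall x y, p (x + y) = p x + p y).
Proof.
move=> sp pmin x z; have [pD _ _] := sp.
have ple y : pull p z y <= p y.
  by have := pull_le z y sp (lexx 0); rewrite scale0r mul0r addr0 subr0.
have /(congr1 (@^~ x)) /= := pmin _ (pull_sublin z sp) ple.
have := pull_le z x sp ler01; rewrite scale1r mul1r; have := pD x z.
by move=> *; apply/eqP; rewrite eq_le; apply/andP; split; lra.
Qed.

(** Take a minimal sublinear functional below pull |.| x0: it is linear, and its value at - x0 is
    at most - |x0|. *)
Lemma norming_functional x0 : exists l : dual X, l x0 = `|x0| /\ forall x, `|l x| <= `|x|.
Proof.
have sq := pull_sublin x0 norm_sublin.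
have [p [sp pq pmin]] := min_sublin sq.
have pD := min_sublin_linear sp pmin.
have p0 := sublin0 sp; have [_ pZ pn] := sp.
have pN x : p (- x) = - p x by have := pD x (- x); rewrite subrr p0; lra.
have lp : linear (p : X -> R^o).
  move=> a x y; rewrite pD; congr (_ + _).
  have [a0|a0|->] := ltgtP a 0; last by rewrite !scale0r p0.
    by rewrite -[a]opprK scaleNr pN pZ ?oppr_gt0// scaleNr.
  exact: pZ.
have np x : `|p x| <= `|x|.
  by rewrite ler_norml pn andbT sublin_ge.
have cp : continuous (p : X -> R^o).
  move=> x; apply/cvgrPdist_lt => e e0; near=> y.
  rewrite -pN -pD; apply: le_lt_trans (np _) _.
  by near: y; exact: (@cvgr_dist_lt _ _ _ _ _ id x).
have pin : (p : X -> R^o) \in clinear X by apply/asboolP.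
exists (Dual pin); split => //=.
have := pq (- x0); have := pull_le x0 (- x0) norm_sublin ler01.
rewrite scale1r addNr normr0 mul1r sub0r pN => h1 h2.
apply/eqP; rewrite eq_le pn /=; lra.
Unshelve. all: by end_near. Qed.

End hahn_banach.

(** * Measures agreeing on a multiplicative class *)

Section sign_iteration.
Context (R : realType).

(** One Newton-Schulz step for the sign function. The iterates are polynomials that stay in
    [-1, 1], so the sign of a function is a bounded pointwise limit of polynomials in it. *)
Definition newton_sign (x : R) : R := x * (3 - x ^+ 2) / 2.

Lemma newton_sign_le1 (x : R) : `|x| <= 1 -> `|newton_sign x| <= 1.
Proof.
rewrite /newton_sign !ler_norml => /andP[? ?].
have : 0 <= (1 - x) ^+ 2 * (2 + x) by rewrite mulr_ge0 ?sqr_ge0//; lra.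
have : 0 <= (1 + x) ^+ 2 * (2 - x) by rewrite mulr_ge0 ?sqr_ge0//; lra.
by move=> *; apply/andP; split; lra.
Qed.

Lemma iter_newton_sign_le1 n (x : R) : `|x| <= 1 -> `|iter n newton_sign x| <= 1.
Proof. by move=> x1; elim: n => // n ih; rewrite iterS newton_sign_le1. Qed.

(** Iterates started at x > 0 stay above x, and there a step multiplies the distance to 1 by at
    most 1 - x / 2. *)
Lemma iter_newton_sign_pos (x : R) : 0 < x <= 1 ->
  (fun n => iter n newton_sign x) @ \oo --> (1 : R).
Proof.
move=> /andP[x0 x1].
have H n : x <= iter n newton_sign x <= 1 /\ 1 - iter n newton_sign x <= (1 - x / 2) ^+ n.
  elim: n => [|n [/andP[h1 h2] h3]]; first by rewrite /= expr0; split; lra.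
  rewrite iterS exprS; set u := iter n _ _ in h1 h2 h3 *.
  have h4 : x <= newton_sign u <= 1.
    have : 0 <= u * (1 - u) * (1 + u) by rewrite !mulr_ge0//; lra.
    have := newton_sign_le1 (x := u); rewrite !ler_norml => /(_ _)/andP[|_].
      by apply/andP; split; lra.
    by rewrite /newton_sign => *; apply/andP; split; lra.
  split => //; apply: le_trans (_ : (1 - x / 2) * (1 - u) <= _); last first.
    by rewrite ler_pM2l//; lra.
  have -> : 1 - newton_sign u = ((2 - u - u ^+ 2) / 2) * (1 - u).
    by rewrite /newton_sign; field.
  by rewrite ler_wpM2r//; nra.
apply/cvgrPdist_le => e e0.
have : (fun n => (1 - x / 2) ^+ n) @ \oo --> (0 : R).
  by apply: cvg_expr; rewrite ltr_norml; apply/andP; split; lra.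
move/cvgrPdist_le => /(_ _ e0); apply: filterS => n.
have [/andP[h1 h2] h3] := H n.
by rewrite sub0r normrN => /(le_trans (ler_norm _)) h4; rewrite ger0_norm; lra.
Qed.

Lemma iter_newton_sign (x : R) : `|x| <= 1 ->
  (fun n => iter n newton_sign x) @ \oo --> Num.sg x.
Proof.
move=> x1; have [x0|x0|->] := ltgtP x 0; last 1 first.
- rewrite sgr0 (_ : (fun _ => _) = cst 0); first exact: cvg_cst.
  by apply/funext => n; elim: n => //= n ->; rewrite /newton_sign !mul0r.
- rewrite ltr0_sg// (_ : (fun _ => _) = (fun n => - iter n newton_sign (- x))).
    apply: cvgN; apply: iter_newton_sign_pos.
    by move: x1; rewrite ltr0_norm// oppr_gt0 x0.
  apply/funext => n; elim: n => [|n ih]; first by rewrite /= opprK.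
  by rewrite !iterS ih /newton_sign; field.
- by rewrite gtr0_sg//; apply: iter_newton_sign_pos; rewrite x0 -(gtr0_norm x0).
Qed.

End sign_iteration.

Section bounded_measurable.
Context d (T : measurableType d) (R : realType).

(** Bounded measurable functions: integrable for every probability measure, and an algebra. *)
Definition bddm (g : T -> R) :=
  measurable_fun setT g /\ exists M, forall x, `|g x| <= M.

Lemma bddm_integrable (P : probability T R) g : bddm g ->
  P.-integrable setT (EFin \o g).
Proof.
move=> [mg [M gM]]; apply: measurable_bounded_integrable => //.
  by rewrite (le_lt_trans (probability_le1 P measurableT))// ltry.
by exists M; split; [exact: num_real|move=> x Mx t _ /=]; rewrite (le_trans (gM t))// ltW.
Qed.

Lemma bddmM f g : bddm f -> bddm g -> bddm (fun x => f x * g x).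
Proof.
move=> [mf [M fM]] [mg [N gN]]; split; first exact: measurable_funM.
by exists (M * N) => x; rewrite normrM ler_pM.
Qed.

Lemma bddm_lin a b f g : bddm f -> bddm g -> bddm (fun x => a * f x + b * g x).
Proof.
move=> [mf [M fM]] [mg [N gN]]; split.
  by apply: measurable_funD; apply: measurable_funM.
exists (`|a| * M + `|b| * N) => x; rewrite (le_trans (ler_normD _ _))//.
by rewrite !normrM lerD// ler_wpM2l.
Qed.

Lemma integral_lin (P : probability T R) a b f g : bddm f -> bddm g ->
  (\int[P]_x (a * f x + b * g x)%:E =
   a%:E * \int[P]_x (f x)%:E + b%:E * \int[P]_x (g x)%:E)%E.
Proof.
move=> bf bg; have If := bddm_integrable P bf; have Ig := bddm_integrable P bg.
under eq_integral do rewrite EFinD !EFinM.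
by rewrite integralD ?integralZl//; exact: integrableZl.
Qed.

Lemma bddm_cvg_integral (P : probability T R) (g_ : (T -> R)^nat) g M :
  (forall n, measurable_fun setT (g_ n)) -> (forall n x, `|g_ n x| <= M) ->
  (forall x, g_ ^~ x @ \oo --> g x) ->
  (fun n => \int[P]_x (g_ n x)%:E)%E @ \oo --> (\int[P]_x (g x)%:E)%E.
Proof.
move=> mg gM gg.
have [|||||] := @dominated_convergence _ _ _ P setT measurableT
  (fun n x => (g_ n x)%:E) (EFin \o g) (cst M%:E).
- by move=> n; apply/measurable_EFinP.
- by apply/measurable_EFinP; apply: measurable_fun_cvg => // x _; exact: gg.
- by apply/aeW => x _; apply: cvg_EFin; [exact: nearW|exact: gg].
- apply: (@bddm_integrable P (cst M)); split => //.
  by exists `|M| => x.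
- by apply/aeW => x n _ /=; rewrite lee_fin.
by [].
Qed.

Lemma indic_le1 (B : set T) x : `|\1_B x : R| <= 1.
Proof. by rewrite indicE; case: (_ \in _); rewrite ?normr1 ?normr0. Qed.

End bounded_measurable.

Section multiplicative_class.
Context d (T : measurableType d) (R : realType) (mu nu : probability T R).
Variable A : set (T -> R).
Hypothesis Am : forall a, A a -> measurable_fun setT a.
Hypothesis A1 : forall a, A a -> forall x, `|a x| <= 1.
Hypothesis Aone : A (cst 1).
Hypothesis AM : forall a b, A a -> A b -> exists c1 c2 a1 a2,
  [/\ A a1, A a2 & forall x, a x * b x = c1 * a1 x + c2 * a2 x].
Hypothesis Aint : forall a, A a ->
  (\int[mu]_x (a x)%:E = \int[nu]_x (a x)%:E)%E.

(** Bounded functions whose products with members of A have the same integral for both measures.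
    This class is linear and closed under bounded limits, but products may leave it. *)
Definition agree : set (T -> R) := [set g | bddm g /\ forall a, A a ->
  (\int[mu]_x (g x * a x)%:E = \int[nu]_x (g x * a x)%:E)%E].

Lemma A_bddm a : A a -> bddm a.
Proof. by move=> Aa; split; [exact: Am|exists 1; exact: A1]. Qed.

Lemma agree_lin a b f g : agree f -> agree g -> agree (fun x => a * f x + b * g x).
Proof.
move=> [bf fE] [bg gE]; split; first exact: bddm_lin.
move=> u Au; under eq_integral do rewrite mulrDl -!mulrA.
under [RHS]eq_integral do rewrite mulrDl -!mulrA.
by have bu := A_bddm Au; rewrite !integral_lin ?fE ?gE//; exact: bddmM.
Qed.

Lemma agreeM a g : A a -> agree g -> agree (fun x => a x * g x).
Proof.
move=> Aa [bg gE]; split; first exact/bddmM/bg/A_bddm.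
move=> b Ab; have [c1 [c2 [a1 [a2 [Aa1 Aa2 abE]]]]] := AM Aa Ab.
have E x : (a x * g x * b x)%:E = (c1 * (g x * a1 x) + c2 * (g x * a2 x))%:E.
  by congr EFin; rewrite mulrAC abE; ring.
under eq_integral do rewrite E; under [RHS]eq_integral do rewrite E.
have b1 := A_bddm Aa1; have b2 := A_bddm Aa2.
by rewrite !integral_lin ?gE//; exact: bddmM.
Qed.

Lemma agree_cvg (g_ : (T -> R)^nat) g M :
  (forall n, agree (g_ n)) -> (forall n x, `|g_ n x| <= M) ->
  (forall x, g_ ^~ x @ \oo --> g x) -> agree g.
Proof.
move=> mg gM gg; have mg_ n : measurable_fun setT (g_ n) by have [[]] := mg n.
have bg : bddm g.
  split; first by apply: measurable_fun_cvg => // x _; exact: gg.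
  exists M => x; rewrite -(cvg_lim (@Rhausdorff R) (cvg_norm (gg x)))//.
  by apply: limr_le; [exact: cvgP (cvg_norm (gg x))|exact: nearW].
split=> // a Aa.
have ba := A_bddm Aa.
have K (P : probability T R) : (fun n => \int[P]_x (g_ n x * a x)%:E)%E @ \oo -->
    (\int[P]_x (g x * a x)%:E)%E.
  apply: (bddm_cvg_integral (M := M)).
  - by move=> n; apply: measurable_funM => //; exact: Am.
  - by move=> n x; rewrite normrM -[M]mulr1 ler_pM// A1.
  - by move=> x; apply: cvgMr_tmp; exact: gg.
have := K nu; under eq_fun do rewrite -(mg _).2//.
by move/(cvg_unique _ (K mu)) => -> .
Qed.

(** The multipliers of the agreement class. Multipliers form an algebra closed under bounded
    pointwise limits, whence their level sets form a sigma-algebra. *)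
Definition multip : set (T -> R) := [set phi | bddm phi /\
  forall g, agree g -> agree (fun x => phi x * g x)].

Lemma multipA a : A a -> multip a.
Proof. by move=> Aa; split; [exact: A_bddm|move=> g; exact: agreeM]. Qed.

Lemma multip_lin a b f g : multip f -> multip g -> multip (fun x => a * f x + b * g x).
Proof.
move=> [bf fE] [bg gE]; split; first exact: bddm_lin.
move=> u Au.
rewrite (_ : (fun _ => _) = (fun x => a * (f x * u x) + b * (g x * u x))).
  by apply: agree_lin; [exact: fE|exact: gE].
by apply/funext => x; ring.
Qed.

Lemma multipM f g : multip f -> multip g -> multip (fun x => f x * g x).
Proof.
move=> [bf fE] [bg gE]; split; first exact: bddmM.
move=> u Au; under eq_fun do rewrite -mulrA.
by apply: (fE (fun x => g x * u x)); exact: gE.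
Qed.

Lemma multip_cvg (g_ : (T -> R)^nat) g M :
  (forall n, multip (g_ n)) -> (forall n x, `|g_ n x| <= M) ->
  (forall x, g_ ^~ x @ \oo --> g x) -> multip g.
Proof.
move=> mg gM gg; have mg_ n : measurable_fun setT (g_ n) by have [[]] := mg n.
split.
  split; first by apply: measurable_fun_cvg => // x _; exact: gg.
  exists M => x; rewrite -(cvg_lim (@Rhausdorff R) (cvg_norm (gg x)))//.
  by apply: limr_le; [exact: cvgP (cvg_norm (gg x))|exact: nearW].
move=> u [[mu_ [N uN]] uE].
apply: (@agree_cvg (fun n x => g_ n x * u x) _ (M * N)).
- by move=> n; apply: (mg n).2; split => //; split => //; exists N.
- by move=> n x; rewrite normrM ler_pM.
- by move=> x; apply: cvgMr_tmp; exact: gg.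
Qed.

Definition msets : set (set T) := [set B | multip (\1_B : T -> R)].

(** The indicator of phi > 0 is (s^2 + s) / 2 for s the sign of phi, and that sign is a bounded
    limit of polynomials in phi. *)
Lemma multip_gt0 phi : multip phi -> (forall x, `|phi x| <= 1) ->
  msets [set x | 0 < phi x].
Proof.
move=> mphi phi1; rewrite /msets /=.
have msg : multip (fun x => Num.sg (phi x)).
  apply: (@multip_cvg (fun n x => iter n (@newton_sign R) (phi x)) _ 1).
  - elim => // n ih.
    rewrite (_ : (fun _ => _) = (fun x => (3 / 2) * iter n (@newton_sign R) (phi x) +
       (- 2^-1) * (iter n (@newton_sign R) (phi x) * (iter n (@newton_sign R) (phi x) * iter n (@newton_sign R) (phi x))))).
      by apply: multip_lin => //; apply: multipM => //; exact: multipM.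
    by apply/funext => x; rewrite iterS /newton_sign; field.
  - by move=> n x; exact: iter_newton_sign_le1.
  - by move=> x; exact: iter_newton_sign.
rewrite (_ : \1__ = (fun x => 2^-1 * (Num.sg (phi x) * Num.sg (phi x)) + 2^-1 * Num.sg (phi x))).
  by apply: multip_lin => //; exact: multipM.
apply/funext => x; rewrite indicE.
have [x0|x0|x0] := ltgtP (phi x) 0.
- rewrite ltr0_sg// memNset /=; first by field.
  by apply/negP; rewrite -leNgt ltW.
- by rewrite gtr0_sg// mem_set//=; field.
- by rewrite x0 sgr0 memNset /= ?x0 ?ltxx//; ring.
Qed.

Lemma msets_gt a c : A a -> msets [set x | c < a x].
Proof.
move=> Aa; have c1 : 0 < 1 + `|c| by rewrite ltr_wpDr.
have h x : (c < a x) = (0 < (1 + `|c|)^-1 * a x + (- (1 + `|c|)^-1 * c) * cst 1 x).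
  by rewrite mulr1 mulNr -mulrBr pmulr_rgt0 ?invr_gt0// subr_gt0.
under eq_set do rewrite h.
apply: multip_gt0; first by apply: multip_lin; exact: multipA.
move=> x; rewrite /= mulr1 mulNr -mulrBr normrM gtr0_norm ?invr_gt0//.
by rewrite mulrC ler_pdivrMr// mul1r (le_trans (ler_normB _ _))// lerD2r A1.
Qed.

Lemma msets_setU B C : msets B -> msets C -> msets (B `|` C).
Proof.
move=> mB mC; rewrite /msets /=.
rewrite (_ : \1__ = (fun x => 1 * (1 * \1_B x + 1 * \1_C x) + (- 1) * (\1_B x * \1_C x))).
  by apply: multip_lin; [exact: multip_lin|exact: multipM].
apply/funext => x; rewrite !indicE in_setU.
by case: (x \in B); case: (x \in C) => /=; ring.
Qed.

Lemma msets_setC B : msets B -> msets (~` B).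
Proof.
move=> mB; rewrite /msets /=.
rewrite (_ : \1__ = (fun x => 1 * cst 1 x + (- 1) * \1_B x)).
  by apply: multip_lin => //; exact: multipA.
by apply/funext => x; rewrite !indicE in_setC; case: (x \in B) => /=; ring.
Qed.

Lemma msets_sigma_algebra : sigma_algebra setT msets.
Proof.
have m0 : msets set0.
  rewrite -setCT; apply: msets_setC; rewrite /msets /= indicT; exact: multipA.
split => //.
- by move=> B mB; rewrite setTD; exact: msets_setC.
- move=> B mB; rewrite /msets /=.
  apply: (@multip_cvg (fun n => \1_(\big[setU/set0]_(i < n) B i)) _ 1).
  + by move=> n; apply: (big_ind msets) => // U V; exact: msets_setU.
  + by move=> n x; exact: indic_le1.
  + move=> x; apply: cvg_near_cst.
    have [[k _ Bkx]|nB] := pselect ((\bigcup_k B k) x).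
      exists k.+1 => // n /= kn; rewrite !indicE !mem_set//; first by exists k.
      by rewrite -bigcup_mkord; exists k.
    apply: nearW => n; rewrite !indicE !memNset// -bigcup_mkord => -[k _ Bkx].
    by apply: nB; exists k.
Qed.

(** Test agreement of the constant 1 times the multiplier 1_B. *)
Lemma multiplicative_class_eq B : msets B -> mu B = nu B.
Proof.
move=> mB; have Ag : agree (cst 1).
  by split; [exact: A_bddm|move=> a Aa; under eq_integral do rewrite mul1r;
   under [RHS]eq_integral do rewrite mul1r; exact: Aint].
have [_ /(_ _ Aone)] := mB.2 _ Ag.
under eq_integral do rewrite !mulr1; under [RHS]eq_integral do rewrite !mulr1.
have mmB : measurable B by rewrite (measurable_indicP R); case: mB => -[].
by rewrite !integral_indic// !setIT.
Qed.

End multiplicative_class.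

(** * Borel sets and characteristic functions *)

Section separable.
Context (R : realType) (X : normedModType R).

Lemma separable_seq : separable_space X ->
  exists a : nat -> X, forall (x : X) (e : R), 0 < e -> exists n, `|x - a n| < e.
Proof.
move=> [S [/countable_injP[f finj] dS]].
exists (fun n => xget 0 [set s | S s /\ f s = n]) => x e e0.
have [s [bs Ss]] := dS (ball x e) (ex_intro _ x (ballxx x e0)) (ball_open x e).
exists (f s); case: xgetP => [y -> [Sy /finj]|/(_ s)]; last by case.
by rewrite !inE => -> //; move: bs; rewrite -ball_normE.
Qed.

Lemma continuous_borel (g : X -> R) : continuous g ->
  measurable_fun setT (g : borel X -> R).
Proof.
move=> cg; apply: (measurability _ (RGenOInfty.measurableE R)) => _ [_ [a ->] <-].
rewrite setTI; apply: sub_sigma_algebra; apply: open_comp => // x _; exact: cg.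
Qed.

Lemma open_borel (U : set X) : open U -> measurable (U : set (borel X)).
Proof. by move=> oU; exact: sub_sigma_algebra. Qed.

Lemma closed_borel (U : set X) : closed U -> measurable (U : set (borel X)).
Proof.
by move=> cU; rewrite -[U]setCK; apply: measurableC; apply: open_borel; exact: closed_openC.
Qed.

(** A closed ball is the intersection of the slabs |l_n (x - c)| <= r over countably many functionals
    norming a dense sequence, and by separability an open set is a countable union of closed balls. *)
Lemma open_of_functionals d (T : measurableType d) (phi : T -> X) :
  separable_space X ->
  (forall l : dual X, measurable_fun setT (fun t => l (phi t) : R)) ->
  forall U : set X, open U -> measurable (phi @^-1` U).
Proof.
move=> /separable_seq[a ad] ml U oU.
have [l lP] := choice (fun n => norming_functional (a n)).
have mball (c : X) (r : R) : measurable (phi @^-1` [set x | `|x - c| <= r]).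
  rewrite (_ : _ @^-1` _ = \bigcap_n [set t | `|l n (phi t) - l n c| <= r]).
    apply: bigcapT_measurable => n.
    have ml' : measurable_fun setT (fun t => `|l n (phi t) - l n c| : R).
      by apply: measurableT_comp => //; apply: measurable_funB.
    by rewrite -[X in measurable X]setTI; exact: (measurable_fun_le measurableT ml' (measurable_cst r)).
  apply/seteqP; split => t /=.
    by move=> h n _ /=; rewrite -dualBr (le_trans ((lP n).2 _)).
  move=> h; rewrite leNgt; apply/negP => rt.
  have e0 : 0 < (`|phi t - c| - r) / 2 by rewrite divr_gt0// subr_gt0.
  have [n nt] := ad (phi t - c) _ e0.
  have := h n I; rewrite /= -dualBr; apply/negP; rewrite -ltNge.
  have := (lP n).1; have := (lP n).2 (phi t - c - a n).
  rewrite dualBr ler_norml => /andP[h1 h2] h3.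
  have := ler_norm (l n (phi t - c)).
  have := lerB_dist (phi t - c) (phi t - c - a n); rewrite subKr; lra.
rewrite (_ : U = \bigcup_(p in [set p : nat * nat | [set x | `|x - a p.1| <= p.2.+1%:R^-1] `<=` U])
   [set x | `|x - a p.1| <= p.2.+1%:R^-1]).
  rewrite preimage_bigcup; pose F (p : nat * nat) :=
     if `[< [set x | `|x - a p.1| <= p.2.+1%:R^-1] `<=` U >]
     then phi @^-1` [set x | `|x - a p.1| <= p.2.+1%:R^-1] else set0.
  rewrite (_ : \bigcup_(_ in _) _ = \bigcup_p F p).
    by apply: countable_bigcupT_measurable => [|p]; [exact: countableP|rewrite /F; case: asboolP => _; [exact: mball|]].
  apply/seteqP; split => t [p pU pt]; exists p => //; rewrite /F.
    by rewrite asboolT.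
  by move: pt; rewrite /F; case: asboolP.
  by move: pt; rewrite /F; case: asboolP.
apply/seteqP; split => [x Ux|x [p pU px]]; last exact: pU.
have [e [e0 eU]] : exists e : R, 0 < e /\ ball x e `<=` U.
  have [e /= e0 eU] := open_subball oU Ux; exists (e / 2); split; first by rewrite divr_gt0.
  by apply: eU; rewrite /= ?divr_gt0// sub0r normrN gtr0_norm ?divr_gt0// ltr_pdivrMr// ltr_pMr// ltr1n.
have e2 : 0 < e / 2 by rewrite divr_gt0.
have [n _ /(_ n (leqnn n))/= ne] := near_infty_natSinv_lt (PosNum e2).
have [k kx] : exists n0 : nat, `|x - a n0| < n.+1%:R^-1 by apply: ad; rewrite invr_gt0.
exists (k, n) => /=; last exact: ltW.
move=> y /= yk; apply: eU; rewrite -ball_normE /=.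
rewrite -(subrKA (a k)) (le_lt_trans (ler_normD _ _))//.
by move: yk kx ne; rewrite [X in X <= _]distrC; move: (n.+1%:R^-1) => q; lra.
Qed.

Lemma measurable_of_functionals d (T : measurableType d) (phi : T -> X) :
  separable_space X ->
  (forall l : dual X, measurable_fun setT (fun t => l (phi t) : R)) ->
  measurable_fun setT (phi : T -> borel X).
Proof.
move=> sepX ml; apply: (@measurability _ _ _ (borel X) setT phi (@open X)) => //.
by move=> _ [B oB <-]; rewrite setTI; exact: open_of_functionals.
Qed.

End separable.

Section charfun_uniqueness.
Context (R : realType) (X : normedModType R).

(** Recovers a functional from the sines of its multiples, which lie in the trigonometric class. *)
Lemma cvg_sin_scale (u : R) : (fun n => n.+1%:R * sin (u / n.+1%:R)) @ \oo --> u.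
Proof.
have d0 : is_derive (0 : R) 1 (@sin R) 1 by rewrite -[1 in X in is_derive _ _ _ X]cos0; exact: is_derive_sin.
have [g [gE gc g0]] := (is_derive1_caratheodory _ _ _).1 d0.
have -> : (fun n => n.+1%:R * sin (u / n.+1%:R)) = (fun n => u * g (u / n.+1%:R)).
  apply/funext => n; have := gE (u / n.+1%:R); rewrite sin0 !subr0 => ->.
  by field.
rewrite -[X in _ --> X]mulr1 -[X in _ * X]g0.
apply: cvgMl_tmp; apply: (@cvg_comp _ _ _ (fun n => u / n.+1%:R) g _ (nbhs (0 : R))); last exact: gc.
have : (fun n => u / n.+1%:R) @ \oo --> u * (0 : R) by apply: cvgMl_tmp; exact: cvg_harmonic.
by rewrite mulr0.
Qed.

Definition trig : set (X -> R) :=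
  [set a | exists l : dual X, a = (fun x => cos (l x)) \/ a = (fun x => sin (l x))].

Lemma trigM a b : trig a -> trig b -> exists c1 c2 a1 a2,
  [/\ trig a1, trig a2 & forall x, a x * b x = c1 * a1 x + c2 * a2 x].
Proof.
move=> [l [->|->]] [m [->|->]].
- exists 2^-1, 2^-1, (fun x => cos ((l - m) x)), (fun x => cos ((l + m) x)).
  split; [by exists (l - m); left|by exists (l + m); left|].
  by move=> x; rewrite dualBE dualDE cosB cosD; field.
- exists 2^-1, (- 2^-1), (fun x => sin ((l + m) x)), (fun x => sin ((l - m) x)).
  split; [by exists (l + m); right|by exists (l - m); right|].
  by move=> x; rewrite dualBE dualDE sinB sinD; field.
- exists 2^-1, 2^-1, (fun x => sin ((l + m) x)), (fun x => sin ((l - m) x)).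
  split; [by exists (l + m); right|by exists (l - m); right|].
  by move=> x; rewrite dualBE dualDE sinB sinD; field.
- exists 2^-1, (- 2^-1), (fun x => cos ((l - m) x)), (fun x => cos ((l + m) x)).
  split; [by exists (l - m); left|by exists (l + m); left|].
  by move=> x; rewrite dualBE dualDE cosB cosD; field.
Qed.

Lemma continuous_cos_dual (l : dual X) : continuous (fun x => cos (l x)).
Proof. by move=> x; apply: continuous_comp; [exact: dual_continuous|exact: continuous_cos]. Qed.

Lemma continuous_sin_dual (l : dual X) : continuous (fun x => sin (l x)).
Proof. by move=> x; apply: continuous_comp; [exact: dual_continuous|exact: continuous_sin]. Qed.

(** Cosines and sines of functionals are closed under products up to linear combinations, so both
    measures agree on the sigma-algebra of their level sets. That sigma-algebra makes all functionals
    measurable, hence contains the Borel sets. *)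
Lemma charfun_unique (mu nu : probability (borel X) R) : separable_space X ->
  (forall l : dual X, (\int[mu]_x (cos (l x))%:E = \int[nu]_x (cos (l x))%:E)%E) ->
  (forall l : dual X, (\int[mu]_x (sin (l x))%:E = \int[nu]_x (sin (l x))%:E)%E) ->
  forall B : set (borel X), measurable B -> mu B = nu B.
Proof.
move=> sepX hc hs B mB.
have Am (a : borel X -> R) : trig a -> measurable_fun setT a.
  move=> [l [->|->]]; apply: continuous_borel.
    exact: continuous_cos_dual.
  exact: continuous_sin_dual.
have A1 (a : borel X -> R) : trig a -> forall x, `|a x| <= 1.
  by move=> [l [->|->]] x; [exact: cos_max|exact: sin_max].
have Aone : trig (cst 1 : borel X -> R).
  by exists 0; left; apply/funext => x; rewrite dual0E cos0.
have Aint (a : borel X -> R) : trig a -> (\int[mu]_x (a x)%:E = \int[nu]_x (a x)%:E)%E.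
  by move=> [l [->|->]].
apply: (multiplicative_class_eq (mu:=mu) (nu:=nu) Am A1 Aone Aint).
have sS := msets_sigma_algebra mu nu Am A1 Aone trigM.
pose S := msets mu nu trig.
pose T' := g_sigma_algebraType S.
have mS (C : set T') : measurable C -> S C by rewrite /measurable/= sigma_algebra_id.
have Sm (C : set X) : S C -> measurable (C : set T') by move=> SC; exact: sub_sigma_algebra.
apply: mS.
have ma (a : X -> R) : trig a -> measurable_fun setT (a : T' -> R).
  move=> ta; apply: (measurability _ (RGenOInfty.measurableE R)) => _ [_ [c ->] <-].
  rewrite setTI; apply: Sm; rewrite (_ : _ @^-1` _ = [set x | c < a x]).
    exact: (msets_gt mu nu Am A1 Aone trigM c ta).
  by apply/seteqP; split => x /=; rewrite in_itv/= andbT.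
have ml (l : dual X) : measurable_fun setT (fun x : T' => l x : R).
  apply: (@measurable_fun_cvg _ T' R setT (fun n (x : X) => n.+1%:R * sin ((n.+1%:R^-1 *: l) x))).
    by move=> n; apply: measurable_funM => //; apply: ma; exists (n.+1%:R^-1 *: l); right.
  move=> x _; have := cvg_sin_scale (u := l x).
  by under eq_fun do rewrite mulrC [l x / _]mulrC mulrC.
have := measurable_of_functionals sepX ml.
by move=> /(_ measurableT B mB); rewrite setTI.
Qed.

End charfun_uniqueness.

(** * Rademacher's theorem on the line *)

Section rademacher.
Context (R : realType).
Local Notation leb := (@lebesgue_measure R).

(** A Lebesgue-null set is covered by intervals of small total length, and mu of the cover is at
    most C times that length. *)
Lemma null_dominates_itv (mu : {measure set (measurableTypeR R) -> \bar R}) (C : R) :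
  0 <= C ->
  (forall a b : R, a <= b -> (mu `]a, b]%classic <= (C * (b - a))%:E)%E) ->
  mu `<< leb.
Proof.
move=> C0 muC; apply/null_content_dominatesP => N mN N0.
apply/eqP; rewrite eq_le measure_ge0 andbT.
apply/lee_addgt0Pr => e e0; rewrite add0e.
have e1 : (0 < (e / (C + 1))%:E)%E by rewrite lte_fin divr_gt0// ltr_wpDl.
have : (leb N < (e / (C + 1))%:E)%E by rewrite N0.
move=> /ereal_inf_lt [_ [A [mA NA] <-] Ae].
have mA' k : measurable (A k : set (measurableTypeR R)) by exact: sub_sigma_algebra.
apply: le_trans (measure_sigma_subadditive mu mA' mN NA) _.
have AC k : (mu (A k) <= C%:E * wlength idfun (A k))%E.
  have [[a b] _ <-] := mA k.
  have [ab|ba] := leP a b.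
    by rewrite wlength_itv_bnd//= -EFinM; exact: muC.
  have E : `]a, b]%classic = set0 :> set R by rewrite set_itv_ge// bnd_simp -leNgt ltW.
  by rewrite /= !E measure0 wlength0 mule0.
apply: (@le_trans _ _ (\sum_(0 <= k <oo) (C%:E * wlength idfun (A k)))%E).
  by apply: lee_nneseries.
rewrite nneseriesZl//.
have C0' : (0 <= C%:E)%E by rewrite lee_fin.
apply: le_trans (lee_wpmul2l C0' (ltW Ae)) _.
by rewrite -EFinM lee_fin mulrA ler_pdivrMr ?ltr_wpDl// mulrDr mulr1 mulrC lerDl ltW.
Qed.

Lemma lipschitzP (V W : normedModType R) (f : V -> W) :
  lipschitz f <-> exists2 L : R, 0 < L & forall x y, `|f x - f y| <= L * `|x - y|.
Proof.
split.
  move=> /= [M [Mr h]]; exists (Num.max 1 (M + 1)) => [|x y]; first by rewrite lt_max ltr01.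
  by apply: (h _ _ (x, y)) => //=; rewrite lt_max ltrDl ltr01 orbT.
move=> [L L0 h]; exists L; split; first exact: num_real.
by move=> M LM [x y] _ /=; rewrite (le_trans (h x y))// ler_wpM2r// ltW.
Qed.

Lemma lipschitz_continuous (V W : normedModType R) (f : V -> W) (L : R) :
  (forall x y, `|f x - f y| <= L * `|x - y|) -> continuous f.
Proof.
move=> h x; apply/cvgrPdist_lt => e e0.
have L1 : 0 < `|L| + 1 by rewrite ltr_wpDl.
near=> y; apply: le_lt_trans (h x y) _.
apply: le_lt_trans (_ : (`|L| + 1) * `|x - y| < e).
  by rewrite ler_wpM2r// (le_trans (ler_norm _))// lerDl.
rewrite mulrC -ltr_pdivlMr//; near: y.
by apply: (@cvgr_dist_lt _ _ _ _ _ id x) => //; rewrite divr_gt0.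
Unshelve. all: by end_near. Qed.

Lemma lebesgue_stieltjes_itv (F : cumulative R R) (a b : R) : a <= b ->
  lebesgue_stieltjes_measure F `]a, b]%classic = (F b - F a)%:E.
Proof.
move=> ab; rewrite /lebesgue_stieltjes_measure /measure_extension.
by rewrite measurable_mu_extE/=; [rewrite wlength_itv_bnd|exact: is_ocitv].
Qed.

(** The Stieltjes measure of G is absolutely continuous, so G is an indefinite integral of its
    Radon-Nikodym density and the Lebesgue differentiation theorem applies. Restricting to a bounded
    interval makes the measure finite. *)
Lemma derivable_cumulative_lipschitz (G : cumulative R R) (L N : R) : 0 < N ->
  (forall x y, x <= y -> G y - G x <= L * (y - x)) ->
  {ae leb, forall x, -N < x < N -> derivable G x 1}.
Proof.
move=> N0 GL.
pose nu : {measure set (measurableTypeR R) -> \bar R} := lebesgue_stieltjes_measure G.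
have nu_itv a b : a <= b -> nu `]a, b]%classic = (G b - G a)%:E.
  exact: lebesgue_stieltjes_itv.
have Gnd : nondecreasing G := cumulative_is_nondecreasing G.
have L0 : 0 <= L.
  by have := GL 0 1 ler01; have := Gnd 0 1 ler01; rewrite -subr_ge0; lra.
have nu_dom : nu `<< leb.
  apply: (@null_dominates_itv nu L) => // a b ab.
  by rewrite nu_itv// lee_fin; exact: GL.
pose D : set (measurableTypeR R) := `]- N, N]%classic.
have mD : measurable D by exact: measurable_itv.
have nuD : (nu D < +oo)%E by rewrite nu_itv ?ltry// ge0_cp// ltW.
pose nuN : {finite_measure set (measurableTypeR R) -> \bar R} := mfrestr mD nuD.
have nuNE A : nuN A = nu (A `&` D) by [].
have dom : charge_of_finite_measure nuN `<< leb.
  apply/null_content_dominatesP => A mA A0.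
  have /null_content_dominatesP/(_ A mA A0) nA0 := nu_dom.
  apply/eqP; rewrite eq_le measure_ge0 andbT -nA0 [leLHS]nuNE le_measure// ?inE//.
  exact: measurableI.
pose g := Radon_Nikodym (charge_of_finite_measure nuN) leb.
have gi := Radon_Nikodym_integrable dom.
have gE A (mA : measurable A) := Radon_Nikodym_integral dom mA.
have gf x := Radon_Nikodym_fin_num x dom.
pose f x := fine (g x).
have fE : EFin \o f = g by apply/funext => x /=; rewrite /f fineK.
have fi : leb.-integrable setT (EFin \o f) by rewrite fE.
have f1 y : leb.-integrable [set` Interval (BRight (-N)) (BRight y)] (EFin \o f).
  by apply: integrableS fi.
have f2 : locally_integrable setT f by apply: open_integrable_locally => //; exact: openT.
have := FTC1 f1 f2; apply: filterS; first exact: (ae_filter_ringOfSetsType leb).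
move=> x /= H /andP[Nx xN].
have Nx' : (BRight (- N) < BRight x)%O by rewrite bnd_simp.
have [+ _] := H Nx'.
have FE y : -N < y <= N -> \int[leb]_(t in [set` Interval (BRight (-N)) (BRight y)]) f t = G y - G (-N).
  move=> /andP[Ny yN]; rewrite /Rintegral.
  have -> : (\int[leb]_(t in [set` Interval (BRight (-N)%R) (BRight y)]) (f t)%:E)%E = (G y - G (-N))%:E.
    rewrite -nu_itv ?ltW//.
    transitivity (nuN `]-N, y]%classic).
      by rewrite [RHS]gE//; apply: eq_integral => t _; rewrite -[LHS]/((EFin \o f) t) fE.
    rewrite nuNE; congr (nu _); apply/setIidl => t /=; rewrite !in_itv/= => /andP[Nt ty]; rewrite /D /= in_itv/= Nt/=; exact: le_trans ty yN.
  by [].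
move=> /(derivableD (derivable_cst (G (-N)) x 1)); apply: near_eq_derivable.
near=> y; rewrite /= fctE FE; first by rewrite addrC subrK.
by apply/andP; split; [near: y; exact: lt_nbhsr|apply/ltW; near: y; exact: lt_nbhsl].
Unshelve. all: by end_near. Qed.

(** Adding L * x to a function of Lipschitz constant L makes it nondecreasing. *)
Lemma derivable_lipschitz (psi : R -> R) : lipschitz psi ->
  {ae leb, forall x, derivable psi x 1}.
Proof.
move=> /lipschitzP[L L0 psiL].
pose G x := psi x + L * x.
have Gnd : nondecreasing G.
  move=> x y xy; rewrite /G; have := psiL x y.
  rewrite ler_norml (ler0_norm (x := x - y)) ?subr_le0// => /andP[h1 h2]; lra.
have Gub x y : x <= y -> G y - G x <= 2 * L * (y - x).
  move=> xy; rewrite /G; have := psiL x y.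
  rewrite ler_norml (ler0_norm (x := x - y)) ?subr_le0// => /andP[h1 h2]; lra.
have Gc : continuous G.
  move=> x; apply: cvgD; first exact: lipschitz_continuous psiL x.
  by apply: cvgMl_tmp; exact: cvg_id.
have Grc : right_continuous G by apply: right_continuousW.
pose GG : cumulative R R := HB.pack G (isCumulative.Build R _ R G Gnd Grc).
have H (n : nat) : {ae leb, forall x, - n.+1%:R < x < n.+1%:R -> derivable G x 1}.
  exact: (@derivable_cumulative_lipschitz GG (2 * L)).
have := ae_foralln H; apply: filterS => x Hx.
have [n nx] : exists n : nat, - n.+1%:R < x < n.+1%:R.
  exists (Num.truncn `|x|); rewrite -ltr_norml; exact: truncnS_gt.
have -> : psi = G - (fun x => L * x) by apply/funext => y; rewrite /G !fctE addrK.
apply: derivableB; first exact: Hx nx.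
exact: derivableM.
Qed.

End rademacher.

(** * Absolute continuity of Gaussian laws on the line *)

Section gaussian_density.
Context (R : realType).

Lemma geometric_sum_le (r : R) n : 0 <= r < 1 -> \sum_(i < n) r ^+ i <= (1 - r)^-1.
Proof.
move=> /andP[r0 r1]; have s0 : 0 < 1 - r by rewrite subr_gt0.
rewrite -(ler_pM2l s0) mulfV ?gt_eqF//.
have := subrX1 r n; have : 0 <= r ^+ n by rewrite exprn_ge0.
set s := \sum_(i < n) _; lra.
Qed.

Lemma two_sided_geometric_sum_le (r : R) j n : 0 <= r < 1 -> (j < n)%N ->
  \sum_(0 <= k < n) r ^+ ((j - k) + (k - j)) <= 2 / (1 - r).
Proof.
move=> r01 jn; rewrite (@big_cat_nat _ _ _ j)//=; last exact: ltnW.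
have H m := geometric_sum_le m r01.
have /andP[r0 r1] := r01.
have -> : 2 / (1 - r) = (1 - r)^-1 + (1 - r)^-1 by ring.
apply: lerD.
  rewrite big_nat_rev/=; apply: le_trans (H j).
  rewrite -(big_mkord xpredT (fun i => r ^+ i)) !big_nat; apply: ler_sum => i /andP[_ ij].
  have -> : (j - (0 + j - i.+1) + (0 + j - i.+1 - j) = i.+1)%N by lia.
  by rewrite exprS ler_piMl ?exprn_ge0// ltW.
rewrite -{1}[j]add0n big_addn; apply: le_trans (H (n - j)%N).
rewrite -(big_mkord xpredT (fun i => r ^+ i)); apply: ler_sum => i _.
by have -> : (j - (i + j) + (i + j - j) = i)%N by lia.
Qed.

(** The kernel is the squared modulus of a geometric sum of characters, hence nonnegative. *)
Lemma fejer_kernelE (x : R) n :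
  \sum_(j < n) \sum_(k < n) cos ((j%:R - k%:R) * x) =
  (\sum_(j < n) cos (j%:R * x)) ^+ 2 + (\sum_(j < n) sin (j%:R * x)) ^+ 2.
Proof.
rewrite !expr2 !big_distrlr/= -big_split/=; apply: eq_bigr => j _.
by rewrite -big_split/=; apply: eq_bigr => k _; rewrite mulrBl cosB.
Qed.

(** On |x| <= 1 / n every angle in the sum is at most 1 in absolute value, so nothing cancels. *)
Lemma fejer_kernel_ge (x : R) n : `|x| <= n.+1%:R^-1 ->
  n.+1%:R ^+ 2 * cos 1 <= \sum_(j < n.+1) \sum_(k < n.+1) cos ((j%:R - k%:R) * x).
Proof.
move=> xn.
have H (j k : 'I_n.+1) : cos 1 <= cos ((j%:R - k%:R) * x).
  rewrite -[leRHS]cos_norm.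
  have jk : `|(j%:R - k%:R) * x| <= 1.
    rewrite normrM; apply: le_trans (_ : n.+1%:R * n.+1%:R^-1 <= 1); last by rewrite mulfV.
    apply: ler_pM => //; rewrite ler_norml.
    have := ltn_ord j; have := ltn_ord k; rewrite -!(ltr_nat R).
    have := ler0n R j; have := ler0n R k; lra.
  have pi1 : 1 <= pi :> R by have := pi_ge2 R; lra.
  move: jk; rewrite le_eqVlt => /orP[/eqP-> //|jk].
  by rewrite ltW// ltr_cos// in_itv/= ?ler01// normr_ge0 (le_trans (ltW jk)).
apply: (@le_trans _ _ (\sum_(j < n.+1) \sum_(k < n.+1) cos 1)).
  rewrite !sumr_const !card_ord; move: (cos 1) => c.
  by rewrite -[_ *+ _ *+ _]mulr_natr -[c *+ _]mulr_natr expr2 [leLHS]mulrC mulrA.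
by apply: ler_sum => j _; apply: ler_sum => k _.
Qed.

Lemma natr_S2_le n : n.+2%:R <= 2 * n.+1%:R :> R.
Proof.
have h : 1 <= n.+1%:R :> R by rewrite ler1n.
by rewrite -[n.+2]addn1 natrD; move: (n.+1%:R) h => q; lra.
Qed.

(** The Fejer kernel centred at a is nonnegative and at least n^2 cos 1 within 1 / n of a, whereas by
    the decay of the characteristic function its integral is O(n). Hence an interval of
    radius 1 / n has mass O(1 / n), and P is dominated by a multiple of Lebesgue measure. *)
Lemma gaussian_charfun_dominates (P : probability (measurableTypeR R) R) (c : R) : 0 < c ->
  (forall s : R, (\int[P]_x (cos (s * x))%:E)%E = (expR (- (c * s ^+ 2)))%:E) ->
  (forall s : R, (\int[P]_x (sin (s * x))%:E)%E = 0%:E) ->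
  P `<< lebesgue_measure.
Proof.
move=> c0 Pcos Psin.
pose r := expR (- c).
have r01 : 0 <= r < 1 by rewrite expR_ge0 /r expR_lt1 oppr_lt0.
have mcos (s a : R) : measurable_fun setT (fun x : measurableTypeR R => cos (s * (x - a))).
  apply: continuous_measurable_fun => x.
  apply: (@continuous_comp _ _ _ (fun x => s * (x - a)) cos); last exact: continuous_cos.
  by apply: cvgMl_tmp; apply: cvgB; [exact: cvg_id|exact: cvg_cst].
have bcos (s a : R) : bddm (fun x : measurableTypeR R => cos (s * (x - a))).
  by split => //; exists 1 => x; exact: cos_max.
have Ecos (s a : R) : (\int[P]_x (cos (s * (x - a)))%:E <= (expR (- (c * s ^+ 2)))%:E)%E.
  have E x : (cos (s * (x - a)))%:E = (cos (s * a) * cos (s * x) + sin (s * a) * sin (s * x))%:E.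
    by rewrite mulrBr cosB; congr EFin; ring.
  under eq_integral do rewrite E.
  have b1 : bddm (fun x : measurableTypeR R => cos (s * x)).
    by have := bcos s 0; under eq_fun do rewrite subr0.
  have b2 : bddm (fun x : measurableTypeR R => sin (s * x)).
    split; last by exists 1 => x; exact: sin_max.
    apply: continuous_measurable_fun => x.
    apply: (@continuous_comp _ _ _ (fun x => s * x) sin); last exact: continuous_sin.
    by apply: cvgMl_tmp; exact: cvg_id.
  rewrite integral_lin// Pcos Psin mule0 adde0 -EFinM lee_fin.
  by rewrite ler_piMl ?expR_ge0// cos_le1.
pose K n a x := \sum_(j < n) \sum_(k < n) cos ((j%:R - k%:R) * (x - a) : R).
have EK n a : (0 < n)%N -> (\int[P]_x (K n a x)%:E <= (n%:R * (2 / (1 - r)))%:E)%E.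
  move=> n0.
  have -> : (\int[P]_x (K n a x)%:E = \sum_(j < n) \sum_(k < n) \int[P]_x (cos ((j%:R - k%:R) * (x - a)))%:E)%E.
    under eq_integral do rewrite /K -sumEFin.
    rewrite integral_sum//.
      apply: eq_bigr => j _; under eq_integral do rewrite -sumEFin.
      by rewrite integral_sum// => k; apply: bddm_integrable.
    move=> j; under eq_fun do rewrite -sumEFin.
    by apply: integrable_sum => // k _; apply: bddm_integrable.
  apply: (@le_trans _ _ (\sum_(j < n) (2 / (1 - r))%:E)%E); last first.
    rewrite [leLHS](_ : _ = (\sum_(j < n) (2 / (1 - r)))%:E); last by rewrite -sumEFin.
    by rewrite lee_fin sumr_const card_ord [n%:R * _]mulr_natl.
  apply: lee_sum => j _.
  apply: (@le_trans _ _ (\sum_(k < n) (r ^+ ((j - k) + (k - j)))%:E)%E); last first.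
    rewrite sumEFin lee_fin -(big_mkord xpredT (fun k => r ^+ ((j - k) + (k - j)))).
    exact: two_sided_geometric_sum_le.
  apply: lee_sum => k _; apply: le_trans (Ecos _ _) _.
  rewrite lee_fin /r -expRM_natl ler_expR mulrN lerN2 mulrC ler_pM2l//.
  have -> : (j%:R - k%:R : R) ^+ 2 = ((j - k) + (k - j))%:R ^+ 2.
    have [jk|jk] := leqP j k.
      by move: (jk); rewrite -subn_eq0 => /eqP ->; rewrite add0n natrB// -sqrrN opprB.
    by have /eqP -> : (k - j == 0)%N; [rewrite subn_eq0 ltnW|rewrite addn0 natrB// ltnW].
  by rewrite -natrX ler_nat; case: (_ + _)%N => // m; rewrite -mulnn leq_pmulr.
have cos10 := cos1_gt0 R.
have r10 : 0 < 1 - r by rewrite subr_gt0; case/andP: r01.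
pose C := 2 / (1 - r) / cos 1.
have C0 : 0 < C by rewrite !divr_gt0.
have PI n a : (P `[(a - n.+1%:R^-1)%R, (a + n.+1%:R^-1)%R]%classic <= (C / n.+1%:R)%:E)%E.
  set I := `[_, _]%classic.
  have mI : measurable (I : set (measurableTypeR R)) by exact: measurable_itv.
  have bI : bddm (\1_I : measurableTypeR R -> R).
    by split => //; exists 1 => x; exact: indic_le1.
  pose w : R := n.+1%:R ^+ 2 * cos 1.
  have w0 : 0 < w by rewrite mulr_gt0// exprn_gt0.
  have : (\int[P]_x (w * \1_I x + 0 * \1_I x)%:E <= \int[P]_x (K n.+1 a x)%:E)%E.
    apply: ge0_le_integral => //.
    - by move=> x _; rewrite lee_fin mul0r addr0 mulr_ge0// ltW.
    - apply/measurable_EFinP; exact: (bddm_lin w 0 bI bI).1.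
    - apply/measurable_EFinP; apply: measurable_sum => j; apply: measurable_sum => k.
      exact: mcos.
    - move=> x _; rewrite lee_fin mul0r addr0 indicE.
      have [xI|xI] := boolP (x \in I).
        rewrite mulr1; apply: fejer_kernel_ge.
        by move: xI; rewrite inE /I /= in_itv/= -ler_distl.
      by rewrite mulr0 /K fejer_kernelE addr_ge0// sqr_ge0.
  rewrite integral_lin// mul0e adde0 integral_indic// setIT => /le_trans/(_ (EK n.+1 a isT)).
  have PIf : P I \is a fin_num by exact: fin_num_measure.
  set pI := (X in (_ * X <= _)%E -> _).
  move=> h0; suff : (pI <= (C / n.+1%:R)%:E)%E by [].
  move: h0; have /fineK <- : pI \is a fin_num by exact: PIf.
  rewrite -EFinM !lee_fin /w /C; move: (fine pI) => p.
  have N0 : 0 < n.+1%:R :> R by [].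
  move: (2 / (1 - r)) (cos 1) cos10 (n.+1%:R : R) N0 => D k k0 N N0 h.
  rewrite ler_pdivlMr// ler_pdivlMr// -(ler_pM2l N0); apply: le_trans h.
  by rewrite le_eqVlt; apply/orP; left; apply/eqP; ring.
(* An interval of length l < 1 is covered by one of radius 1 / n with n the integer part of
   1 / l, and 1 / n <= 2 l. *)
clearbody C.
apply: (@null_dominates_itv _ P (1 + 2 * C)); first by rewrite addr_ge0// mulr_ge0// ltW.
move=> a b ab.
have mab : measurable (`]a, b]%classic : set (measurableTypeR R)) by exact: measurable_itv.
have [<-|nab] := eqVneq a b.
  by rewrite subrr mulr0 set_itv_ge ?measure0// bnd_simp ltxx.
have l0 : 0 < b - a by rewrite subr_gt0 lt_neqAle nab.
have [l1|l1] := leP 1 (b - a).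
  apply: le_trans (probability_le1 P mab) _.
  have CC : 0 <= 2 * C * (b - a) by rewrite mulr_ge0 ?ltW// mulr_gt0.
  by rewrite lee_fin mulrDl mul1r; lra.
pose n := (Num.truncn (b - a)^-1).-1.
have nE : n.+1 = Num.truncn (b - a)^-1.
  by rewrite /n prednK// truncn_gt0 invf_ge1// ltW.
have /andP[n1 n2] : n.+1%:R <= (b - a)^-1 < n.+2%:R.
  by rewrite nE; apply: truncn_itv; rewrite invr_ge0 ltW.
have n3 : b - a <= n.+1%:R^-1 by rewrite -[leLHS]invrK lef_pV2// posrE ?invr_gt0.
have mI : measurable (`[((a + b) / 2 - n.+1%:R^-1)%R, ((a + b) / 2 + n.+1%:R^-1)%R]%classic : set (measurableTypeR R)).
  exact: measurable_itv.
apply: (@le_trans _ _ (P `[((a + b) / 2 - n.+1%:R^-1)%R, ((a + b) / 2 + n.+1%:R^-1)%R]%classic)).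
  apply: le_measure; rewrite ?inE//.
  move: n3; move: (n.+1%:R^-1) => q n3 x /=; rewrite !in_itv/= => /andP[ax xb].
  by apply/andP; split; lra.
apply: le_trans (PI _ _) _; rewrite lee_fin mulrDl mul1r.
have : n.+1%:R^-1 <= 2 * (b - a).
  have h1 : 1 < n.+2%:R * (b - a) by rewrite -ltr_pdivrMr// div1r.
  have h2 : n.+2%:R * (b - a) <= (2 * n.+1%:R) * (b - a).
    by apply: ler_wpM2r; [exact: ltW|exact: natr_S2_le].
  by rewrite -[leLHS]mul1r ler_pdivrMr//; lra.
move=> h; have : C / n.+1%:R <= C * (2 * (b - a)) by rewrite ler_pM2l.
move: (C / _) => q; lra.
Qed.

End gaussian_density.

(** * Splitting a Gaussian measure along a direction *)

Lemma integral_prod_mul d1 d2 (T1 : measurableType d1) (T2 : measurableType d2)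
    (R : realType) (P1 : probability T1 R) (P2 : probability T2 R)
    (f : T1 -> R) (g : T2 -> R) : bddm f -> bddm g ->
  (\int[P1 \x P2]_z (f z.1 * g z.2)%:E =
   (\int[P1]_x (f x)%:E) * \int[P2]_y (g y)%:E)%E.
Proof.
move=> bf bg; have If := bddm_integrable P1 bf; have Ig := bddm_integrable P2 bg.
have bfg : bddm (fun z : T1 * T2 => f z.1 * g z.2).
  apply: bddmM.
    by case: bf => mf [M fM]; split; [exact: measurableT_comp|exists M => z].
  by case: bg => mf [M fM]; split; [exact: measurableT_comp|exists M => z].
have Ifg : (P1 \x P2)%E.-integrable setT (fun z => (f z.1 * g z.2)%:E).
  exact: (@bddm_integrable _ _ _ (P1 \x P2)%E).
rewrite -integral12_prod_meas1// /fubini_F/=.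
have gfin : (\int[P2]_y (g y)%:E)%E \is a fin_num by exact: integrable_fin_num.
transitivity (\int[P1]_x ((f x)%:E * \int[P2]_y (g y)%:E))%E.
  by apply: eq_integral => x _; under eq_integral do rewrite EFinM; rewrite integralZl.
rewrite -(fineK gfin); under eq_integral do rewrite muleC.
by rewrite integralZl// muleC.
Qed.

Lemma integral_distribution_bdd d1 d2 (T1 : measurableType d1) (T2 : measurableType d2)
    (R : realType) (P : probability T1 R) (Y : {mfun T1 >-> T2}) (f : T2 -> R) :
  bddm f ->
  (\int[distribution P Y]_y (f y)%:E = \int[P]_x (f (Y x))%:E)%E.
Proof.
move=> bf; rewrite integral_distribution//.
  by apply/measurable_EFinP; case: bf.
apply: (@bddm_integrable _ _ _ P (f \o Y)).
by case: bf => mf [M fM]; split; [exact: measurableT_comp|exists M => x; exact: fM].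
Qed.

Lemma bddm_cos_scale (R : realType) (s : R) : bddm (fun t : R => cos (s * t)).
Proof.
split; last by exists 1 => x; exact: cos_max.
apply: continuous_measurable_fun => x.
apply: (@continuous_comp _ _ _ (fun x => s * x) cos); last exact: continuous_cos.
by apply: cvgMl_tmp; exact: cvg_id.
Qed.

Lemma bddm_sin_scale (R : realType) (s : R) : bddm (fun t : R => sin (s * t)).
Proof.
split; last by exists 1 => x; exact: sin_max.
apply: continuous_measurable_fun => x.
apply: (@continuous_comp _ _ _ (fun x => s * x) sin); last exact: continuous_sin.
by apply: cvgMl_tmp; exact: cvg_id.
Qed.

Lemma bddm_comp d1 d2 (T1 : measurableType d1) (T2 : measurableType d2) (R : realType)
    (f : T2 -> R) (g : T1 -> T2) : bddm f -> measurable_fun setT g -> bddm (fun x => f (g x)).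
Proof.
by move=> [mf [M fM]] mg; split; [exact: measurableT_comp|exists M => x; exact: fM].
Qed.

Section decomposition.
Context (R : realType) (X : normedModType R) (sepX : separable_space X)
  (gamma : probability (borel X) R) (Q : {linear dual X -> X})
  (gaussX : centred_gaussian gamma Q) (ndQ : nondegenerate_cov Q)
  (h : X) (hh : dual X) (hQ : h = Q hh) (h0 : h != 0).

Lemma bddm_cos_dual (l : dual X) : bddm (fun x : borel X => cos (l x)).
Proof.
split; last by exists 1 => x; exact: cos_max.
by apply: continuous_borel; exact: continuous_cos_dual.
Qed.

Lemma bddm_sin_dual (l : dual X) : bddm (fun x : borel X => sin (l x)).
Proof.
split; last by exists 1 => x; exact: sin_max.
by apply: continuous_borel; exact: continuous_sin_dual.
Qed.

Lemma gaussian_cos (l : dual X) :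
  (\int[gamma]_x (cos (l x))%:E = (expR (- (2^-1 * l (Q l))))%:E)%E.
Proof.
have [_ _ /(_ l)[<- _]] := gaussX; rewrite fineK//.
exact: integrable_fin_num (bddm_integrable gamma (bddm_cos_dual l)).
Qed.

Lemma gaussian_sin (l : dual X) : (\int[gamma]_x (sin (l x))%:E = 0%:E)%E.
Proof.
have [_ _ /(_ l)[_ <-]] := gaussX; rewrite fineK//.
exact: integrable_fin_num (bddm_integrable gamma (bddm_sin_dual l)).
Qed.

Lemma hh_h_gt0 : 0 < hh h.
Proof.
rewrite hQ; apply: ndQ; apply: contra_neq h0 => hh0.
by rewrite hQ hh0 linear0.
Qed.

Lemma measurable_dual (l : dual X) : measurable_fun setT (fun x : borel X => l x : R).
Proof. by apply: continuous_borel; exact: dual_continuous. Qed.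

Lemma measurable_coord : measurable_fun setT (fun x : borel X => hh x / hh h : R).
Proof. by apply: measurable_funM => //; exact: measurable_dual. Qed.

Lemma measurable_perp : measurable_fun setT (fun x : borel X => x - proj_h h hh x : borel X).
Proof.
apply: measurable_of_functionals => // l.
apply: continuous_borel => x.
apply: (@continuous_comp _ _ _ (fun t => t - proj_h h hh t) l); last exact: dual_continuous.
apply: cvgB; first exact: cvg_id.
by rewrite /proj_h; apply: cvgZr_tmp; apply: cvgMr_tmp; exact: dual_continuous.
Qed.

Definition coord_mfun : {mfun borel X >-> R} :=
  HB.pack (fun x : borel X => hh x / hh h : R)
    (isMeasurableFun.Build _ _ _ _ _ measurable_coord).

Definition coord_borel_mfun : {mfun borel X >-> measurableTypeR R} :=
  HB.pack (fun x : borel X => hh x / hh h : measurableTypeR R)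
    (isMeasurableFun.Build _ _ _ (measurableTypeR R) _ measurable_coord).

Definition perp_mfun : {mfun borel X >-> borel X} :=
  HB.pack (fun x : borel X => x - proj_h h hh x : borel X)
    (isMeasurableFun.Build _ _ _ _ _ measurable_perp).

Definition law_coord : probability R R := distribution gamma coord_mfun.
Definition law_perp : probability (borel X) R := distribution gamma perp_mfun.

Definition recombine (z : R * borel X) : borel X := (z.2 : X) + z.1 *: h.

Lemma measurable_recombine : measurable_fun setT recombine.
Proof.
apply: (@measurable_of_functionals _ _ _ _ recombine) => // l.
rewrite /recombine; under eq_fun do rewrite dualDr dualZr.
apply: measurable_funD; last by apply: measurable_funM.
by apply: (measurableT_comp (f := (l : borel X -> R))) => //; exact: measurable_dual.
Qed.

Lemma scale_coord (s : R) (x : X) : s * (hh x / hh h) = ((s / hh h) *: hh) x.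
Proof. by rewrite dualZE mulrA mulrAC. Qed.

Lemma gaussian_coord_cos (s : R) :
  (\int[gamma]_x (cos (s * (hh x / hh h)))%:E = (expR (- (2^-1 * (hh h)^-1 * s ^+ 2)))%:E)%E.
Proof.
have hh0 := hh_h_gt0.
transitivity (\int[gamma]_x (cos (((s / hh h) *: hh) x))%:E)%E.
  by apply: eq_integral => x _; rewrite -scale_coord.
rewrite gaussian_cos [Q (_ *: _)]linearZ dualZr -hQ dualZE; congr (expR (- _))%:E.
by field; rewrite gt_eqF.
Qed.

Lemma gaussian_coord_sin (s : R) :
  (\int[gamma]_x (sin (s * (hh x / hh h)))%:E = 0%:E)%E.
Proof.
transitivity (\int[gamma]_x (sin (((s / hh h) *: hh) x))%:E)%E.
  by apply: eq_integral => x _; rewrite -scale_coord.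
exact: gaussian_sin.
Qed.

Lemma law_coord_cos (s : R) :
  (\int[law_coord]_t (cos (s * t))%:E = (expR (- (2^-1 * (hh h)^-1 * s ^+ 2)))%:E)%E.
Proof.
by rewrite /law_coord integral_distribution_bdd; [exact: gaussian_coord_cos|exact: bddm_cos_scale].
Qed.

Lemma law_coord_sin (s : R) : (\int[law_coord]_t (sin (s * t))%:E = 0%:E)%E.
Proof.
by rewrite /law_coord integral_distribution_bdd; [exact: gaussian_coord_sin|exact: bddm_sin_scale].
Qed.

(** The coordinate along h is Gaussian with positive variance, so its law is absolutely continuous. *)
Lemma law_coord_ae (P : R -> Prop) :
  {ae @lebesgue_measure R, forall t, P t} -> {ae law_coord, forall t, P t}.
Proof.
have c0 : 0 < 2^-1 * (hh h)^-1 by rewrite mulr_gt0 ?invr_gt0// hh_h_gt0.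
have Hc (s : R) : (\int[distribution gamma coord_borel_mfun]_t (cos (s * t))%:E
    = (expR (- (2^-1 * (hh h)^-1 * s ^+ 2)))%:E)%E.
  by rewrite integral_distribution_bdd; [exact: gaussian_coord_cos|exact: bddm_cos_scale].
have Hs (s : R) : (\int[distribution gamma coord_borel_mfun]_t (sin (s * t))%:E = 0%:E)%E.
  by rewrite integral_distribution_bdd; [exact: gaussian_coord_sin|exact: bddm_sin_scale].
have /null_content_dominatesP H := gaussian_charfun_dominates c0 Hc Hs.
by move=> [A [mA A0 PA]]; exists A; split => //; exact: H.
Qed.

(** The functional l composed with the projection x - proj_h x. It vanishes at h. *)
Definition perp_dual (l : dual X) : dual X := l - (l h / hh h) *: hh.

Lemma perp_dualE l (x : X) : perp_dual l x = l (x - proj_h h hh x).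
Proof.
rewrite /perp_dual dualBE dualZE /proj_h dualBr dualZr; congr (_ - _).
by rewrite mulrAC [RHS]mulrAC [l h * _]mulrC.
Qed.

Lemma law_perp_cos (l : dual X) :
  (\int[law_perp]_y (cos (l y))%:E = (expR (- (2^-1 * perp_dual l (Q (perp_dual l)))))%:E)%E.
Proof.
rewrite -gaussian_cos /law_perp integral_distribution_bdd; last exact: bddm_cos_dual.
by apply: eq_integral => x _; rewrite perp_dualE.
Qed.

Lemma law_perp_sin (l : dual X) : (\int[law_perp]_y (sin (l y))%:E = 0%:E)%E.
Proof.
rewrite -(gaussian_sin (perp_dual l)) /law_perp integral_distribution_bdd; last exact: bddm_sin_dual.
by apply: eq_integral => x _; rewrite perp_dualE.
Qed.

(** There is no cross term: the covariance of perp_dual l and hh is perp_dual l evaluated at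
    Q hh = h, which is zero. *)
Lemma cov_split (l : dual X) :
  l (Q l) = (hh h)^-1 * (l h) ^+ 2 + perp_dual l (Q (perp_dual l)).
Proof.
have hh0 := hh_h_gt0; have [_ Qsym _] := gaussX.
have ml : perp_dual l h = 0.
  by rewrite /perp_dual dualBE dualZE divfK ?gt_eqF// subrr.
have lE : l = (l h / hh h) *: hh + perp_dual l by rewrite /perp_dual addrC subrK.
have QE : Q l = (l h / hh h) *: h + Q (perp_dual l).
  by rewrite {1}lE linearD [Q (_ *: _)]linearZ -hQ.
rewrite QE dualDr dualZr; congr (_ + _); first by ring.
rewrite {1}lE dualDE dualZE (Qsym (perp_dual l) hh) -hQ ml mulr0 add0r//.
Qed.

Definition recombine_mfun : {mfun (R * borel X)%type >-> borel X} :=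
  HB.pack recombine (isMeasurableFun.Build _ _ _ _ _ measurable_recombine).

(** Under the product of the two marginal laws, recombination has characteristic function
    exp (- (h-part + perpendicular part) / 2), which by cov_split is that of gamma. *)
Lemma gaussian_decomposition (B : set (borel X)) : measurable B ->
  gamma B = (law_coord \x law_perp)%E (recombine @^-1` B).
Proof.
move=> mB.
pose P12 : probability (R * borel X)%type R := (law_coord \x law_perp)%E.
apply: (charfun_unique (mu := gamma) (nu := distribution P12 recombine_mfun)) => //.
- move=> l.
  have bc := bddm_cos_scale (l h); have bs := bddm_sin_scale (l h).
  have bcl := bddm_cos_dual l; have bsl := bddm_sin_dual l.
  rewrite integral_distribution_bdd//.
  transitivity (\int[P12]_z (1 * (cos (l h * z.1) * cos (l z.2)) + (-1) * (sin (l h * z.1) * sin (l z.2)))%:E)%E; last first.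
    apply: eq_integral => z _; congr EFin.
    rewrite [recombine_mfun z]/(recombine z) /recombine dualDr dualZr [z.1 * _]mulrC cosD; ring.
  have E1 := integral_prod_mul law_coord law_perp bc bcl.
  have E2 := integral_prod_mul law_coord law_perp bs bsl.
  rewrite /= in E1 E2.
  rewrite integral_lin; last 2 first.
  - by apply: bddmM; [exact: (bddm_comp bc measurable_fst)|exact: (bddm_comp bcl measurable_snd)].
  - by apply: bddmM; [exact: (bddm_comp bs measurable_fst)|exact: (bddm_comp bsl measurable_snd)].
  rewrite /P12 E1 E2 law_coord_sin mul0e mule0 adde0 mul1e.
  rewrite law_coord_cos law_perp_cos gaussian_cos -EFinM -expRD (cov_split l).
  by congr (expR _)%:E; field; rewrite gt_eqF// hh_h_gt0.
- move=> l.
  have bc := bddm_cos_scale (l h); have bs := bddm_sin_scale (l h).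
  have bcl := bddm_cos_dual l; have bsl := bddm_sin_dual l.
  rewrite integral_distribution_bdd//.
  transitivity (\int[P12]_z (1 * (sin (l h * z.1) * cos (l z.2)) + 1 * (cos (l h * z.1) * sin (l z.2)))%:E)%E; last first.
    apply: eq_integral => z _; congr EFin.
    rewrite [recombine_mfun z]/(recombine z) /recombine dualDr dualZr [z.1 * _]mulrC sinD; ring.
  have E1 := integral_prod_mul law_coord law_perp bs bcl.
  have E2 := integral_prod_mul law_coord law_perp bc bsl.
  rewrite /= in E1 E2.
  rewrite integral_lin; last 2 first.
  - by apply: bddmM; [exact: (bddm_comp bs measurable_fst)|exact: (bddm_comp bcl measurable_snd)].
  - by apply: bddmM; [exact: (bddm_comp bc measurable_fst)|exact: (bddm_comp bsl measurable_snd)].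
  rewrite /P12 E1 E2 law_coord_sin law_perp_sin mul0e !mule0 adde0.
  exact: gaussian_sin.
Qed.

Lemma ge0_gaussian_fubini (F : borel X -> \bar R) : measurable_fun setT F ->
  (forall x, 0 <= F x)%E ->
  (\int[gamma]_x F x = \int[law_coord \x law_perp]_z F (recombine z))%E.
Proof.
move=> mF F0.
pose P12 : probability (R * borel X)%type R := (law_coord \x law_perp)%E.
transitivity (\int[distribution P12 recombine_mfun]_y F y)%E; last first.
  by rewrite (ge0_integral_distribution recombine_mfun).
by apply: eq_measure_integral => B mB _; exact: (gaussian_decomposition mB).
Qed.

Lemma gaussian_integrable (F : borel X -> \bar R) : gamma.-integrable setT F ->
  (law_coord \x law_perp)%E.-integrable setT (F \o recombine).
Proof.
move=> /integrableP[mF Foo]; apply/integrableP; split.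
  by apply: measurableT_comp => //; exact: measurable_recombine.
by move: Foo; rewrite ge0_gaussian_fubini//; exact: measurableT_comp.
Qed.

Lemma gaussian_fubini (F : borel X -> \bar R) : gamma.-integrable setT F ->
  (\int[gamma]_x F x = \int[law_coord \x law_perp]_z F (recombine z))%E.
Proof.
move=> iF; have mF := measurable_int gamma iF.
rewrite integralE [RHS]integralE; congr (_ - _)%E.
  rewrite ge0_gaussian_fubini//; first by apply: eq_integral => z _; rewrite !funeposE.
  exact: measurable_funepos.
rewrite ge0_gaussian_fubini//; first by apply: eq_integral => z _; rewrite !funenegE.
exact: measurable_funeneg.
Qed.

Lemma law_perp_ker : law_perp [set y : borel X | hh y = 0] = 1%:E.
Proof.
have -> : law_perp [set y : borel X | hh y = 0] = gamma (perp_mfun @^-1` [set y | hh y = 0]) by [].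
rewrite (_ : _ @^-1` _ = setT) ?probability_setT//.
apply/seteqP; split => // x _ /=; rewrite /proj_h dualBr dualZr divfK ?subrr// gt_eqF//.
exact: hh_h_gt0.
Qed.

End decomposition.

(** * Directional derivatives and sections *)

(** The integral of a nonnegative function is a supremum over simple functions below it, so
    monotonicity holds without measurability. The variation of a section, as a function of the
    base point, is an uncountable supremum that is only handled through this fact. *)
Lemma ge0_le_lower_integral d (T : measurableType d) (R : realType)
    (mu : {measure set T -> \bar R}) (D : set T) (f g : T -> \bar R) :
  (forall x, D x -> 0 <= f x)%E -> (forall x, D x -> f x <= g x)%E ->
  (\int[mu]_(x in D) f x <= \int[mu]_(x in D) g x)%E.
Proof.
move=> f0 fg; rewrite ge0_integralE// ge0_integralE; last first.
  by move=> x Dx; apply: le_trans (fg x Dx); exact: f0.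
apply: le_ereal_sup => _ [k kf <-]; exists k => // x.
apply: le_trans (kf x) _; rewrite !patchE; case: ifPn => // /set_mem; exact: fg.
Qed.

Section punctured_limit.
Context d (T : measurableType d) (R : realType) (q : R -> T -> R).
Hypothesis mq : forall t, measurable_fun setT (q t).
Hypothesis cq : forall x t, t != 0 -> {for t, continuous (fun s => q s x)}.

Let ball0 (k : nat) (t : R) := (t != 0) && (`|t| < k.+1%:R^-1).
Let s0 (k : nat) : R := k.+2%:R^-1.

Let s0P k : ball0 k (s0 k).
Proof.
rewrite /ball0 /s0 invr_eq0 pnatr_eq0/= gtr0_norm ?invr_gt0//.
by rewrite ltf_pV2 ?posrE// ltr_nat.
Qed.

Let cvg_set : set T := \bigcap_(m in [set: nat]) \bigcup_(k in [set: nat])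
  \bigcap_(r in [set: rat]) [set x | ball0 k (ratr r) -> `|q (s0 k) x - q (ratr r) x| <= m.+1%:R^-1].

Let measurable_cvg_set : measurable cvg_set.
Proof.
apply: bigcapT_measurable => m; apply: bigcupT_measurable => k.
rewrite -[X in measurable X]setCK setC_bigcap; apply: measurableC.
apply: countable_bigcupT_measurable => [|r]; first exact: countableP.
apply: measurableC.
have [b|nb] := boolP (ball0 k (ratr r)); last first.
  by rewrite (_ : mkset _ = setT)//; apply/seteqP; split.
rewrite (_ : mkset _ = setT `&` [set x | `|q (s0 k) x - q (ratr r) x| <= m.+1%:R^-1]).
  apply: measurable_fun_le => //; apply: measurableT_comp => //.
  exact: measurable_funB.
by rewrite setTI; apply/seteqP; split => x /=; [exact|move=> + _].
Qed.

Let cvg_setP x : cvg_set x <-> cvg (q t x @[t --> (0 : R)^']).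
Proof.
split.
  move=> Dx; apply/cauchy_cvgP; apply: cauchy_exP => e e0.
  have [m _ /(_ m (leqnn m))/= me] := near_infty_natSinv_lt (PosNum e0).
  have [k _ Hk] := Dx m I.
  exists (q (s0 k) x); near=> t; rewrite -ball_normE /=.
  have tb : ball0 k t.
    rewrite /ball0; apply/andP; split; first by near: t; exact: nbhs_dnbhs_neq.
    by near: t; exact: dnbhs0_lt.
  apply: le_lt_trans me; apply/ler_addgt0Pr => _/posnumP[eta].
  have /andP[t0 tk] := tb.
  have [r [rb rt]] : exists r : rat, ball0 k (ratr r) /\ `|q t x - q (ratr r) x| < eta%:num.
    have tp : 0 < `|t| by rewrite normr_gt0.
    have tk' : 0 < k.+1%:R^-1 - `|t| by rewrite subr_gt0.
    have : \forall s \near t, ball0 k s /\ `|q t x - q s x| < eta%:num.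
      near=> s; split; last first.
        by near: s; apply: (@cvgr_dist_lt _ _ _ _ _ (q^~ x) (q t x)) => //; exact: cq.
      have h1 : `|t - s| < `|t| by near: s; apply: (@cvgr_dist_lt _ _ _ _ _ id t).
      have h2 : `|t - s| < k.+1%:R^-1 - `|t|.
        by near: s; apply: (@cvgr_dist_lt _ _ _ _ _ id t).
      rewrite /ball0; apply/andP; split.
        by apply: contraTneq h1 => ->; rewrite subr0 ltxx.
      rewrite -(subKr t s); apply: le_lt_trans (ler_normB _ _) _.
      by rewrite -ltrBrDl.
    move=> /nbhs_ballP[d0 /= d00 Hd].
    have [z [bd [r _ rz]]] := dense_rat (ex_intro _ t (ballxx t d00)) (ball_open t d0).
    by exists r; apply: Hd; rewrite rz.
  apply: le_trans (ler_distD (q (ratr r) x) _ _) _.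
  by rewrite lerD ?Hk// distrC ltW.
move=> /cvg_ex[l /= ql] m _.
have m2 : 0 < (m.+1%:R^-1 / 2 : R) by rewrite divr_gt0.
have : \forall t \near (0 : R)^', `|l - q t x| < m.+1%:R^-1 / 2.
  by apply: (@cvgr_dist_lt _ _ _ _ _ (q^~ x) l).
move=> [/= e e0 He].
have [k _ /(_ k (leqnn k))/= ke] := near_infty_natSinv_lt (PosNum e0).
have H t : ball0 k t -> `|l - q t x| < m.+1%:R^-1 / 2.
  move=> /andP[t0 tk]; apply: He => //=; rewrite sub0r normrN; exact: lt_trans ke.
exists k => // r _ /= rb; apply: le_trans (ler_distD l _ _) _.
have := H _ (s0P k); have := H _ rb; rewrite [`|q (s0 k) x - l|]distrC.
move: (m.+1%:R^-1) => u; lra.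
Unshelve. all: by end_near. Qed.

(** Convergence is a Cauchy condition that, by continuity in t, can be tested at countably many t;
    where it fails the limit takes a constant default value. *)
Lemma measurable_punctured_lim : measurable_fun setT (fun x => lim (q t x @[t --> (0 : R)^']) : R).
Proof.
pose g n x := if x \in cvg_set then q (s0 n) x else point : R.
apply: (@measurable_fun_cvg _ _ _ _ g).
  move=> n; apply: measurable_fun_ifT => //.
  apply: (measurable_fun_bool true); rewrite setTI (_ : _ @^-1` _ = cvg_set)//.
  by apply/seteqP; split => x /=; [move/set_mem|move/mem_set].
move=> x _; rewrite /g; have [xD|xD] := pselect (cvg_set x).
  under eq_fun do rewrite (mem_set xD).
  have qc := (cvg_setP x).1 xD.
  have s00 : s0 @ \oo --> (0 : R)^'.
    move=> P [/= e e0 He]; suff : \forall n \near \oo, P (s0 n) by [].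
    near=> n; apply: He => /=.
      rewrite sub0r normrN gtr0_norm ?invr_gt0//.
      have ne : n.+1%:R^-1 < e by near: n; exact: near_infty_natSinv_lt (PosNum e0).
      by apply: lt_trans ne; rewrite ltf_pV2 ?posrE// ltr_nat.
    by rewrite invr_eq0 pnatr_eq0.
  exact: cvg_comp s00 qc.
under eq_fun do rewrite (memNset xD).
rewrite dvgP; first exact: cvg_cst.
by move=> /(cvg_setP x).2.
Unshelve. all: by end_near. Qed.

End punctured_limit.

Section directional.
Context (R : realType) (X : normedModType R).
Implicit Types (G : X -> R^o) (h x y : X).

(** The map phi allows the source to carry a measurable structure other than the one attached to the
    type X, such as its Borel sigma-algebra. *)
Lemma measurable_derive d (T : measurableType d) (phi : T -> X) G h : continuous G ->
  (forall g : X -> R, continuous g -> measurable_fun setT (fun z => g (phi z))) ->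
  measurable_fun setT (fun z => 'D_h G (phi z) : R).
Proof.
move=> cG mphi; rewrite /derive.
apply: (@measurable_punctured_lim _ T R (fun t z => t^-1 *: (G (t *: h + phi z) - G (phi z)))).
- move=> t; apply: measurable_funM => //; apply: measurable_funB; last exact: mphi.
  apply: (mphi (fun x => G (t *: h + x))) => x.
  apply: (@continuous_comp _ _ _ (fun x => t *: h + x) G); last exact: cG.
  by apply: cvgD; [exact: cvg_cst|exact: cvg_id].
- move=> z t t0.
  have Gt : {for t, continuous (fun t : R => G (t *: h + phi z))}.
    apply: (@continuous_comp _ _ _ (fun t : R => t *: h + phi z) G); last exact: cG.
    by apply: cvgD; [apply: cvgZr_tmp; exact: cvg_id|exact: cvg_cst].
  apply: cvgM; first exact: cvgV.
  apply: cvgB; [exact: Gt|exact: cvg_cst].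
Qed.

(** Where the derivative does not exist its value is a fixed default, which the bound must also cover. *)
Lemma derive_bounded G h (L : R) : (forall x y, `|G x - G y| <= L * `|x - y|) ->
  exists C : R, forall x, `|'D_h G x| <= C.
Proof.
move=> GL; exists (Num.max (L * `|h|) `|point : R|) => x; rewrite le_max.
have [dG|ndG] := pselect (derivable G x h); last by rewrite /derive dvgP ?lexx ?orbT.
apply/orP; left.
have Gc : `|t^-1 *: ((G \o shift x) (t *: h) - G x)| @[t --> (0 : R)^'] --> `|'D_h G x|.
  by apply: cvg_norm; exact: dG.
rewrite -(cvg_lim _ Gc)//; apply: limr_le; first exact: cvgP Gc.
near=> t; rewrite normrZ normrV ?unitfE//; last by near: t; exact: nbhs_dnbhs_neq.
rewrite mulrC ler_pdivrMr ?normr_gt0; last by near: t; exact: nbhs_dnbhs_neq.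
apply: le_trans (GL _ _) _; rewrite /= addrK normrZ.
by rewrite -mulrA [`|h| * _]mulrC.
Unshelve. all: by end_near. Qed.

Lemma derive1_section G h y t :
  derive1 (fun s => G (y + s *: h) : R^o) t = 'D_h G (y + t *: h).
Proof.
rewrite /derive1 /derive (_ : (fun s : R => _) = (fun s : R =>
  s^-1 *: ((G \o shift (y + t *: h)) (s *: h) - G (y + t *: h))))//.
by apply/funext => s /=; rewrite scalerDl addrCA.
Qed.

(** The support of the section lies in the section of the support, and dividing by |h| converts
    distances in X to distances in the parameter. *)
Lemma lip_c_section (O : set X) G h y : h != 0 -> lip_c O G ->
  lip_c (section_set O h y) (fun s => G (y + s *: h) : R^o).
Proof.
move=> h0 [Gb /lipschitzP[L L0 GL] Sb SO [d d0 Hd]].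
have hp : 0 < `|h| by rewrite normr_gt0.
have csec : continuous (fun s : R => y + s *: h).
  by move=> s; apply: cvgD; [exact: cvg_cst|apply: cvgZr_tmp; exact: cvg_id].
have Ssec s : closure [set s | G (y + s *: h) != 0] s -> closure [set x | G x != 0] (y + s *: h).
  move=> cs B /(csec s) /cs [s' [/= Gs' Bs']].
  by exists (y + s' *: h).
split.
- by case: Gb => M [Mr HM]; exists M; split => // N MN s _; exact: (HM N MN (y + s *: h) I).
- apply/lipschitzP; exists (L * `|h|); first by rewrite mulr_gt0.
  move=> s t; apply: le_trans (GL _ _) _.
  by rewrite opprD addrACA subrr add0r -scalerBl normrZ mulrA mulrAC.
- case: Sb => M [Mr HM].
  exists ((M + 1 + `|y|) / `|h|); split; first exact: num_real.
  move=> N MN s /Ssec Ss /=; apply: le_trans (ltW MN).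
  rewrite ler_pdivlMr// -normrZ.
  have := HM (M + 1); rewrite ltrDl ltr01 => /(_ isT _ Ss) /=.
  have := ler_normB (y + s *: h) y; rewrite [y + s *: h - y]addrC addKr; lra.
- by move=> s /Ssec/SO.
- exists (d / `|h|); first by rewrite divr_gt0.
  move=> s t /Ssec Ss Ot; rewrite ler_pdivrMr//.
  by have := Hd _ _ Ss Ot; rewrite opprD addrACA subrr add0r -scalerBl normrZ.
Qed.

End directional.

(** * Restricting test functions to lines *)

Lemma integrable_bddm d (T : measurableType d) (R : realType) (P : probability T R)
    (f w : T -> R) : P.-integrable setT (EFin \o f) -> bddm w ->
  P.-integrable setT (fun x => (f x * w x)%:E).
Proof.
move=> If [mw [M wM]].
have /(_ If mw) := @integrableMl _ _ _ P setT measurableT (EFin \o f) w.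
apply; exists M; split; first exact: num_real.
by move=> N MN x _ /=; apply: le_trans (wM x) (ltW MN).
Qed.

Lemma integral_restrictM d (T : measurableType d) (R : realType) (mu : {measure set T -> \bar R})
    (D : set T) (f w : T -> R) :
  (\int[mu]_(x in D) (f x * w x)%:E = \int[mu]_x ((f \_ D) x * w x)%:E)%E.
Proof.
rewrite integral_mkcond; apply: eq_integral => x _; rewrite !patchE.
by case: ifP => // _; rewrite mul0r.
Qed.

Lemma Vgamma1_ge0 (R : realType) (mu : {measure set R -> \bar R}) v g U :
  (0 <= Vgamma1 mu v g U)%E.
Proof.
apply: ereal_sup_ubound; exists (cst 0).
  split; last by move=> t _; rewrite normr0.
  have S0 : closure [set x : R | (cst 0 : R -> R) x != 0] = set0.
    by rewrite (_ : mkset _ = set0) ?closure0//; apply/seteqP; split => x //=; rewrite eqxx.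
  split; rewrite ?S0 //.
  - by exists 0; split => // N N0 x _ /=; rewrite normr0 ltW.
  - by apply/lipschitzP; exists 1 => // x y; rewrite subrr normr0 mul1r.
  - by exists 0; split => // N N0 x.
  - by exists 1.
rewrite integral0_eq// => x _; rewrite /gauss_div1 derive1E.
by rewrite derive_cst mulr0 subrr mulr0.
Qed.

Lemma bounded_fun_bound (R : realType) (X : normedModType R) (G : X -> R^o) :
  bounded_fun G -> exists2 M : R, 0 < M & forall x, `|G x| <= M.
Proof.
case=> M [Mr HM]; exists (Num.max 0 M + 1).
  by rewrite ltr_wpDl// le_max lexx.
by move=> x; apply: HM => //; rewrite ltr_pwDr// le_max lexx orbT.
Qed.

Lemma bounded_set_bound (R : realType) (X : normedModType R) (S : set X) :
  bounded_set S -> exists2 M : R, 0 < M & forall x, S x -> `|x| <= M.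
Proof.
case=> M [Mr HM]; exists (Num.max 0 M + 1).
  by rewrite ltr_wpDl// le_max lexx.
by move=> x; apply: HM => //; rewrite ltr_pwDr// le_max lexx orbT.
Qed.

Lemma dual_bound (R : realType) (X : normedModType R) (l : dual X) :
  exists2 C : R, 0 < C & forall x, `|l x| <= C * `|x|.
Proof.
have lc := @dual_continuous R X l.
have : bounded_near l (nbhs (0 : X)) by apply: continuous_linear_bounded; exact: lc.
move=> /linear_boundedP H; near (+oo : set_system R) => C.
exists C; first by near: C; exact: nbhs_pinfty_gt.
by near: C.
Unshelve. all: by end_near. Qed.

Section upper_bound.
Context (R : realType) (X : normedModType R) (sepX : separable_space X)
  (gamma : probability (borel X) R) (Q : {linear dual X -> X})
  (gaussX : centred_gaussian gamma Q) (ndQ : nondegenerate_cov Q)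
  (h : X) (hh : dual X) (hQ : h = Q hh) (h0 : h != 0)
  (O : set X) (openO : open O) (f : X -> R)
  (intf : gamma.-integrable O (EFin \o f)).

Let P1 : probability R R := law_coord gamma h hh.
Let P2 : probability (borel X) R := law_perp sepX gamma h hh.
Let hh0 : 0 < hh h. Proof. exact: (hh_h_gt0 ndQ hQ h0). Qed.

Lemma integrable_restrict_open : gamma.-integrable setT (EFin \o (f \_ O : borel X -> R)).
Proof.
have mO : measurable (O : set (borel X)) by exact: open_borel.
by have /(integrable_mkcond _ mO) := intf; rewrite restrict_EFin.
Qed.

(** The factor hh is unbounded, but G has bounded support. *)
Lemma bddm_dstar (G : X -> R^o) : lip_c O G -> bddm (fun x : borel X => dstar h hh G x).
Proof.
move=> [/bounded_fun_bound[M M0 GM] /lipschitzP[L L0 GL] /bounded_set_bound[r r0 Sr] _ _].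
have cG := lipschitz_continuous GL.
have [C DC] := derive_bounded h GL.
have [K K0 hK] := dual_bound hh.
split.
  apply: measurable_funB.
    apply: (measurable_derive (phi := id : borel X -> X)) => // g cg.
    exact: continuous_borel.
  apply: measurable_funM; first exact: continuous_borel.
  exact: measurable_dual.
exists (C + M * (K * r)) => x; apply: le_trans (ler_normB _ _) _.
rewrite lerD// normrM; have [->|Gx] := eqVneq (G x) 0.
  by rewrite normr0 mul0r !mulr_ge0// ltW.
rewrite ler_pM//; apply: le_trans (hK x) _; rewrite ler_pM2l//.
by apply: Sr; exact: subset_closure.
Qed.

Lemma gaussian_fubini_weighted (w : borel X -> R) : bddm w ->
  (\int[gamma]_(x in O) (f x * w x)%:E =
   \int[P2]_y \int[P1]_t (((f \_ O) (recombine h (t, y))) * w (recombine h (t, y)))%:E)%E.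
Proof.
move=> bw; have IF := integrable_bddm integrable_restrict_open bw.
rewrite integral_restrictM (gaussian_fubini sepX gaussX ndQ hQ h0 IF).
by rewrite -(integral21_prod_meas1 (gaussian_integrable sepX gaussX ndQ hQ h0 IF)).
Qed.

(** On a line parallel to h through the kernel of hh, the Gaussian divergence of G is the
    one-dimensional divergence of its section, an admissible test function there; integrate over
    the lines. Only the positive part of the inner integral is compared, since the sectional variation
    is merely known to be nonnegative. *)
Lemma variation_le_sections (G : X -> R^o) : lip_c O G ->
  (forall x, O x -> `|G x| <= 1) ->
  (\int[gamma]_(x in O) (f x * dstar h hh G x)%:E <=
   \int[P2]_(y in [set y : X | hh y = 0%R]) Vgamma1 P1 (hh h)^-1
     (section_fun f h y) (section_set O h y))%E.
Proof.
move=> GO G1; have bG := bddm_dstar GO.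
rewrite gaussian_fubini_weighted//.
pose I y := (\int[P1]_t (((f \_ O) (recombine h (t, y))) * dstar h hh G (recombine h (t, y)))%:E)%E.
have IF := integrable_bddm integrable_restrict_open bG.
have mI : measurable_fun setT I.
  exact: (measurable_fubini_G (gaussian_integrable sepX gaussX ndQ hQ h0 IF)).
have IV y : hh y = 0 -> (I y <= Vgamma1 P1 (hh h)^-1 (section_fun f h y) (section_set O h y))%E.
  move=> hy; apply: ereal_sup_ubound; exists (fun s => G (y + s *: h)).
    by split; [exact: lip_c_section|move=> t; exact: G1].
  rewrite integral_restrictM; apply: eq_integral => t _; congr (_ * _)%:E.
  by rewrite /gauss_div1 (derive1_section G) /dstar /recombine /= dualDr dualZr hy add0r invrK mulrC.
have mK : measurable [set y : borel X | hh y = 0].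
  have := measurable_dual hh measurableT (measurable_set1 0).
  by rewrite setTI.
have K0 : P2 (~` [set y : borel X | hh y = 0]) = 0%E.
  by rewrite probability_setC// (law_perp_ker _ _ ndQ hQ h0) subee.
apply: (@le_trans _ _ (\int[P2]_y (I^\+ y))%E).
  by rewrite [leLHS]integralE geeDl// oppe_le0 integral_ge0.
rewrite (ge0_negligible_integral (measurableC mK) measurableT)//; last first.
  exact: measurable_funepos.
rewrite setTD setCK; apply: ge0_le_lower_integral => y // /IV.
by rewrite funeposE ge_max Vgamma1_ge0 andbT.
Qed.

End upper_bound.

(** * Approximating signs by Lipschitz cutoffs *)

Lemma min_dist_le (R : realDomainType) (a b c d K : R) :
  `|a - c| <= K -> `|b - d| <= K -> `|Num.min a b - Num.min c d| <= K.
Proof.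
rewrite !ler_norml => /andP[a1 a2] /andP[b1 b2].
by case: (leP a b) => ?; case: (leP c d) => ?; apply/andP; split; lra.
Qed.

Lemma max_dist_le (R : realDomainType) (a b c d K : R) :
  `|a - c| <= K -> `|b - d| <= K -> `|Num.max a b - Num.max c d| <= K.
Proof.
rewrite !ler_norml => /andP[a1 a2] /andP[b1 b2].
by case: (leP a b) => ?; case: (leP c d) => ?; apply/andP; split; lra.
Qed.

Lemma sub_dist_le (R : realDomainType) (a b c d : R) :
  `|a - b - (c - d)| <= `|a - c| + `|b - d|.
Proof. by rewrite (_ : a - b - (c - d) = a - c - (b - d)) ?ler_normB//; ring. Qed.

Section capped_distance.
Context (R : realType) (X : normedModType R) (E : set X).
Implicit Types x y e : X.

Let dists x : set R := [set r | r = 1 \/ exists2 e, E e & r = `|x - e|].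

(** The distance to E capped at 1, so that an empty E needs no convention for the infimum. *)
Definition cdist x : R := inf (dists x).

Let dists_ge0 x r : dists x r -> 0 <= r.
Proof. by move=> [->//|[e _ ->]]. Qed.

Let dists_lb x : has_lbound (dists x).
Proof. by exists 0 => r /dists_ge0. Qed.

Let dists_inf x : has_inf (dists x).
Proof. by split => //; exists 1; left. Qed.

Lemma cdist_ge0 x : 0 <= cdist x.
Proof. by apply: lb_le_inf; [exists 1; left|move=> r /dists_ge0]. Qed.

Lemma cdist_le x e : E e -> cdist x <= `|x - e|.
Proof. by move=> Ee; apply: ge_inf => //; right; exists e. Qed.

Lemma cdist_le1 x : cdist x <= 1.
Proof. by apply: ge_inf => //; left. Qed.

Lemma cdist0 x : E x -> cdist x = 0.
Proof.
move=> Ex; apply/eqP; rewrite eq_le cdist_ge0 andbT.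
by have := cdist_le x Ex; rewrite subrr normr0.
Qed.

Let cdist_step x y : cdist x <= cdist y + `|x - y|.
Proof.
rewrite -lerBlDr; apply: lb_le_inf; first by exists 1; left.
move=> r [->|[e Ee ->]]; rewrite lerBlDr.
  by apply: le_trans (cdist_le1 x) _; rewrite lerDl.
by apply: le_trans (cdist_le x Ee) _; rewrite [leRHS]addrC; exact: ler_distD.
Qed.

Lemma cdist_lip x y : `|cdist x - cdist y| <= `|x - y|.
Proof.
have h1 := cdist_step x y; have h2 := cdist_step y x; rewrite distrC in h2.
by rewrite ler_norml; apply/andP; split; lra.
Qed.

Lemma cdist_gt0 x : closed E -> ~ E x -> 0 < cdist x.
Proof.
move=> cE nEx.
have /nbhs_ballP[d /= d0 dE] : nbhs x (~` E).
  by apply: open_nbhs_nbhs; split => //; exact: closed_openC.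
apply: (@lt_le_trans _ _ (Num.min 1 d)); first by rewrite lt_min ltr01.
apply: lb_le_inf; first by exists 1; left.
move=> r [->|[e Ee ->]]; first by rewrite ge_min lexx.
rewrite ge_min; apply/orP; right; rewrite leNgt; apply/negP => xe.
by apply: (dE e) Ee; rewrite -ball_normE.
Qed.

End capped_distance.

Section approximation.
Context (R : realType) (X : normedModType R).
Implicit Types (E B W : set X) (chi : X -> R^o).

(** The requirements on the factor chi of a test function that is constant along h. In the application E
    consists of the points whose translates along a segment of the line leave O. *)
Definition cutoff E chi := [/\
  exists2 L : R, 0 < L & forall x y, `|chi x - chi y| <= L * `|x - y|,
  forall x, `|chi x| <= 1,
  exists r : R, forall x, chi x != 0 -> `|x| <= r &
  exists2 d : R, 0 < d & forall x e, chi x != 0 -> E e -> d <= `|x - e| ].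

Lemma cutoff_bddm E chi : cutoff E chi -> bddm (chi : borel X -> R).
Proof.
move=> [[L L0 cL] c1 _ _]; split; last by exists 1.
by apply: continuous_borel; exact: lipschitz_continuous cL.
Qed.

(** Used with m the difference and with m the positive part of the difference. *)
Lemma cutoff_comb E (m : R -> R -> R) chi1 chi2 :
  (forall a b c d, `|m a b - m c d| <= `|a - c| + `|b - d|) ->
  m 0 0 = 0 -> (forall a b, 0 <= a <= 1 -> 0 <= b <= 1 -> `|m a b| <= 1) ->
  (forall x, 0 <= chi1 x) -> (forall x, 0 <= chi2 x) ->
  cutoff E chi1 -> cutoff E chi2 -> cutoff E (fun x => m (chi1 x) (chi2 x)).
Proof.
move=> mL m0 m1 p1 p2 [[L L0 cL] c1 [r Hr] [d d0 Hd]] [[L' L0' cL'] c1' [r' Hr'] [d' d0' Hd']].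
have nz x : m (chi1 x) (chi2 x) != 0 -> chi1 x != 0 \/ chi2 x != 0.
  have [->|] := eqVneq (chi1 x) 0; last by left.
  by have [->|] := eqVneq (chi2 x) 0; [rewrite m0 eqxx|right].
split.
- exists (L + L'); first exact: addr_gt0.
  by move=> x y; apply: le_trans (mL _ _ _ _) _; rewrite mulrDl lerD.
- by move=> x; apply: m1; rewrite ?p1 ?p2 (le_trans (ler_norm _)).
- exists (Num.max r r') => x /nz[/Hr|/Hr'] H; rewrite le_max H ?orbT//.
- exists (Num.min d d'); first by rewrite lt_min d0.
  by move=> x e /nz[/Hd H|/Hd' H] Ee; rewrite ge_min H ?orbT.
Qed.

(** For closed E this increases to 1 off E as n grows, while for each n it vanishes near E and outside
    a ball. *)
Let clip E (n : nat) x : R :=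
  Num.min 1 (Num.max 0 (Num.min (n%:R * cdist E x - 1) (n%:R - `|x|))).

Let clip01 E n x : 0 <= clip E n x <= 1.
Proof. by rewrite /clip le_min ler01 le_max lexx/= ge_min lexx. Qed.

Let clip_cutoff E F n : F `<=` E -> cutoff F (clip E n).
Proof.
move=> FE.
have nz x : clip E n x != 0 -> 0 < n%:R * cdist E x - 1 /\ 0 < n%:R - `|x|.
  have /andP[p _] := clip01 E n x; move=> c0.
  have : 0 < clip E n x by rewrite lt_neqAle eq_sym c0.
  by rewrite /clip lt_min lt_max ltxx/= lt_min => /andP[_ /andP].
split.
- exists n.+1%:R => // x y.
  apply: min_dist_le; first by rewrite subrr normr0 mulr_ge0.
  apply: max_dist_le; first by rewrite subrr normr0 mulr_ge0.
  apply: min_dist_le.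
    rewrite opprB addrA subrK -mulrBr normrM ger0_norm//.
    by rewrite ler_pM// ?cdist_lip// ler_nat.
  rewrite (_ : _ - _ = `|y| - `|x|); last by ring.
  apply: le_trans (ler_dist_dist _ _) _; rewrite distrC.
  by rewrite ler_peMl// ler1n.
- by move=> x; have /andP[p q] := clip01 E n x; rewrite ger0_norm.
- by exists n%:R => x /nz[_]; rewrite subr_gt0 => /ltW.
- exists n.+1%:R^-1; first by rewrite invr_gt0.
  move=> x e /nz[+ _] /FE Ee; rewrite subr_gt0 => nx.
  apply: le_trans (cdist_le x Ee).
  have n0 : (0 : R) < n%:R.
    by rewrite lt_neqAle ler0n andbT; apply: contraTneq nx => <-; rewrite mul0r ltr10.
  apply: (@le_trans _ _ (n%:R^-1)); first by rewrite lef_pV2 ?posrE// ler_nat.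
  by rewrite -[n%:R^-1]mulr1 ler_pdivrMl// ltW.
Qed.

Let clip_cvg E x : closed E -> (fun n => clip E n x) @ \oo --> (\1_(~` E) x : R).
Proof.
move=> cE; rewrite indicE; have [Ex|nEx] := pselect (E x).
  rewrite memNset//; apply: cvg_near_cst; near=> n.
  rewrite /clip cdist0// mulr0 sub0r.
  have m0 : Num.min (-1) (n%:R - `|x|) <= 0 :> R by rewrite ge_min lerN10.
  by rewrite (max_l m0) min_r.
rewrite mem_set//; apply: cvg_near_cst; near=> n.
have d0 := cdist_gt0 cE nEx.
have h1 : 1 + `|x| <= n%:R by near: n; exact: nbhs_infty_ger.
have h2 : 2 / cdist E x <= n%:R by near: n; exact: nbhs_infty_ger.
rewrite ler_pdivrMr// in h2.
rewrite /clip min_l// le_max le_min.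
apply/orP; right; apply/andP; split; lra.
Unshelve. all: by end_near. Qed.

Context (P : probability (borel X) R) (c : borel X -> R).
Hypothesis intc : P.-integrable setT (EFin \o c).

Let mc : measurable_fun setT c.
Proof. by apply/measurable_EFinP; exact: measurable_int intc. Qed.

(** The seminorm of L^1 with density |c|. *)
Let N (phi : borel X -> R) : \bar R := (\int[P]_x (`|c x| * `|phi x|)%:E)%E.

Let mN (phi : borel X -> R) : measurable_fun setT phi ->
  measurable_fun setT (fun x => (`|c x| * `|phi x|)%:E).
Proof.
by move=> mp; apply/measurable_EFinP; apply: measurable_funM; exact: measurableT_comp.
Qed.

Let ND (phi psi chi : borel X -> R) : measurable_fun setT phi -> measurable_fun setT psi -> measurable_fun setT chi ->
  (forall x, `|chi x| <= `|phi x| + `|psi x|) -> (N chi <= N phi + N psi)%E.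
Proof.
move=> mphi mpsi mchi H; rewrite /N -ge0_integralD//; last 2 first.
- exact: mN.
- exact: mN.
apply: ge0_le_integral => //; first exact: mN.
  by apply: emeasurable_funD; exact: mN.
by move=> x _; rewrite -EFinD lee_fin -mulrDr ler_wpM2l.
Qed.

Let N_cvg0 (phi : nat -> borel X -> R) : (forall n, measurable_fun setT (phi n)) ->
  (forall n x, `|phi n x| <= 1) -> (forall x, phi ^~ x @ \oo --> (0 : R)) ->
  forall e : R, 0 < e -> exists n, (N (phi n) <= e%:E)%E.
Proof.
move=> mphi phi1 phi0 e e0.
have [|||||_ _] := @dominated_convergence _ _ _ P setT measurableT
  (fun n x => (`|c x| * `|phi n x|)%:E) (cst 0%E) (fun x => `|c x|%:E).
- by move=> n; exact: mN.
- exact: measurable_cst.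
- apply/aeW => x _; apply: cvg_EFin; first exact: nearW.
  rewrite /comp/= (_ : 0 = `|c x| * `|0 : R|); last by rewrite normr0 mulr0.
  by apply: cvgMl_tmp; apply: cvg_norm; exact: phi0.
- have := integrable_abse intc; rewrite (_ : (_ \o _)%FUN = (fun x => `|c x|%:E))//.
- by apply/aeW => x n _; rewrite /= lee_fin normrM !normr_id ler_piMr.
rewrite integral0 => /fine_cvgP[fN].
move=> /(@cvgr_le _ _ _ _ _ _)/(_ e e0) fe.
near \oo => n; exists n.
have Nfin : N (phi n) \is a fin_num by near: n.
by rewrite -(fineK Nfin) lee_fin; near: n.
Unshelve. all: by end_near. Qed.

Variables (E : set X) (cE : closed E).

(** Approximation, in the weighted norm, of the part of B off E by admissible cutoffs. These sets B
    form a lambda-system containing the open sets. *)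
Let approximable B := forall e : R, 0 < e -> exists chi,
  [/\ cutoff E chi, forall x, 0 <= chi x &
      (N (fun x => chi x - \1_(B `\` E) x)%R <= e%:E)%E].

Let mE : measurable (E : set (borel X)). Proof. exact: closed_borel. Qed.

Let mind B : measurable (B : set (borel X)) -> measurable_fun setT (\1_(B `\` E) : borel X -> R).
Proof. by move=> mB; apply: measurable_indic; exact: measurableD. Qed.

(** The cutoffs for the closed set ~` W `|` E vanish near it, in particular near E, and converge to the
    indicator of its complement. *)
Let approximable_open W : open W -> approximable W.
Proof.
move=> oW e e0; pose F := ~` W `|` E.
have cF : closed F by apply: closedU => //; exact: open_closedC.
have FE : ~` F = W `\` E by rewrite setCU setCK.
have EF : E `<=` F by move=> x; right.
have mW : measurable (W : set (borel X)) by exact: open_borel.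
have mcl n : measurable_fun setT (clip F n : borel X -> R).
  by have [] := cutoff_bddm (clip_cutoff n EF).
have [|||n Hn] := @N_cvg0 (fun n x => clip F n x - \1_(W `\` E) x) _ _ _ e e0.
- by move=> n; apply: measurable_funB; [exact: mcl|exact: mind].
- move=> n x; have /andP[p q] := clip01 F n x; rewrite indicE ler_norml.
  by case: (x \in _); apply/andP; split => /=; lra.
- move=> x; rewrite (_ : 0 = \1_(W `\` E) x - \1_(W `\` E) x); last by rewrite subrr.
  by apply: cvgB; [rewrite -FE; exact: clip_cvg|exact: cvg_cst].
exists (clip F n); split => //; first exact: clip_cutoff.
by move=> x; have /andP[] := clip01 F n x.
Qed.

Let approximableD A B : measurable (A : set (borel X)) -> measurable (B : set (borel X)) ->
  B `<=` A -> approximable A -> approximable B -> approximable (A `\` B).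
Proof.
move=> mA mB BA aA aB e e0; have e2 : 0 < e / 2 by rewrite divr_gt0.
have [ca [cuta a0 Na]] := aA _ e2; have [cb [cutb b0 Nb]] := aB _ e2.
pose chi x := Num.max (ca x - cb x) 0.
have cutc : cutoff E chi.
  apply: (@cutoff_comb E (fun a b => Num.max (a - b) 0)) => //.
  - move=> a b c' d; apply: max_dist_le; last by rewrite subrr normr0 addr_ge0.
    exact: sub_dist_le.
  - by rewrite subrr maxxx.
  - move=> a b /andP[? ?] /andP[? ?]; rewrite ger0_norm ?le_max ?lexx ?orbT//.
    by rewrite ge_max ler01 andbT; lra.
exists chi; split => //; first by move=> x; rewrite /chi le_max lexx orbT.
have [ma _] := cutoff_bddm cuta; have [mb _] := cutoff_bddm cutb; have [mchi _] := cutoff_bddm cutc.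
apply: (@le_trans _ _ (e / 2 + e / 2)%:E); last by rewrite -splitr.
rewrite EFinD; apply: le_trans (leeD Na Nb).
apply: ND.
- by apply: measurable_funB => //; exact: mind.
- by apply: measurable_funB => //; exact: mind.
- by apply: measurable_funB => //; apply: mind; exact: measurableD.
move=> x; have -> : \1_((A `\` B) `\` E) x = Num.max (\1_(A `\` E) x - \1_(B `\` E) x) 0 :> R.
  rewrite !indicE !in_setD; case: (x \in E) => /=; rewrite ?andbF ?subrr ?maxxx//.
  rewrite !andbT; have [xB|xB] := boolP (x \in B).
    by rewrite (mem_set (BA _ (set_mem xB))) subrr maxxx.
  by rewrite andbT subr0 max_l.
apply: max_dist_le; last by rewrite subrr normr0 addr_ge0.
exact: sub_dist_le.
Qed.

Let approximable_bigcup (F : nat -> set X) : (forall n, measurable (F n : set (borel X))) ->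
  nondecreasing_seq F -> (forall n, approximable (F n)) -> approximable (\bigcup_n F n).
Proof.
move=> mF ndF aF e e0; have e2 : 0 < e / 2 by rewrite divr_gt0.
have mU : measurable (\bigcup_n F n : set (borel X)) by exact: bigcupT_measurable.
have [|||n Hn] := @N_cvg0 (fun n x => \1_(F n `\` E) x - \1_((\bigcup_n F n) `\` E) x) _ _ _ _ e2.
- by move=> n; apply: measurable_funB; exact: mind.
- move=> n x; rewrite !indicE ler_norml.
  by case: (x \in _); case: (x \in _); apply/andP; split => /=; lra.
- move=> x; apply: cvg_near_cst.
  have [[[k _ Fk] nE]|nU] := pselect (((\bigcup_n F n) `\` E) x).
    near=> n; rewrite !indicE !mem_set ?subrr//; split => //.
      by exists k.
    have kn : (k <= n)%N by near: n; exists k.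
    by have /subsetPset := ndF _ _ kn; apply.
  apply: nearW => n; rewrite !indicE memNset ?memNset ?subrr// => -[Fn nE].
  by apply: nU; split => //; exists n.
have [chi [cutc c0 Nc]] := aF n _ e2.
exists chi; split => //.
have [mchi _] := cutoff_bddm cutc.
apply: (@le_trans _ _ (e / 2 + e / 2)%:E); last by rewrite -splitr.
rewrite EFinD; apply: le_trans (leeD Nc Hn).
apply: ND.
- by apply: measurable_funB => //; exact: mind.
- by apply: measurable_funB; exact: mind.
- by apply: measurable_funB => //; exact: mind.
move=> x; apply: le_trans (ler_normD _ _); rewrite addrA subrK//.
Unshelve. all: by end_near. Qed.

Let approximable_borel B : measurable (B : set (borel X)) -> approximable B.
Proof.
move: B.
suff H : <<s @open X >> `<=` [set B | measurable (B : set (borel X)) /\ approximable B].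
  by move=> B /H[].
apply: lambda_system_subset => //.
- by move=> A C; exact: openI.
- split => //.
  + by split; [exact: measurableT|apply: approximable_open; exact: openT].
  + move=> A C CA [mA aA] [mC aC]; split; first exact: measurableD.
    exact: approximableD.
  + move=> F ndF FH; split; first by apply: bigcupT_measurable => n; have [] := FH n.
    by apply: approximable_bigcup => // n; have [] := FH n.
- by move=> W oW; split; [exact: open_borel|exact: approximable_open].
Qed.

(** Approximating the sets where c is positive and where c is negative, the difference of the
    two cutoffs approximates the sign of c off E. *)
Lemma cutoff_approx (e : R) : 0 < e -> exists2 chi, cutoff E chi &
  (\int[P]_x (`|c x| * \1_(~` E) x)%:E <= \int[P]_x (c x * chi x)%:E + e%:E)%E.
Proof.
move=> e0; have e2 : 0 < e / 2 by rewrite divr_gt0.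
have mpos : measurable ([set x | 0 < c x] : set (borel X)).
  by have := mc measurableT (measurable_itv `]0, +oo[%R); rewrite setTI set_itvoy.
have mneg : measurable ([set x | c x < 0] : set (borel X)).
  by have := mc measurableT (measurable_itv `]-oo, 0[%R); rewrite setTI set_itvNyo.
have [ca [cuta a0 Na]] := approximable_borel mpos e2.
have [cb [cutb b0 Nb]] := approximable_borel mneg e2.
have cutc : cutoff E (fun x => ca x - cb x).
  apply: (@cutoff_comb E (fun a b => a - b)) => //.
  - move=> a b c' d; exact: sub_dist_le.
  - by rewrite subrr.
  - by move=> a b /andP[? ?] /andP[? ?]; rewrite ler_norml; apply/andP; split; lra.
exists (fun x => ca x - cb x) => //.
have dev (B : set X) (chi : X -> R^o) : measurable (B : set (borel X)) -> cutoff E chi ->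
    bddm (fun x : borel X => `|chi x - \1_(B `\` E) x|).
  move=> mB cc; have [m1 _] := cutoff_bddm cc; have [_ c1 _ _] := cc; split.
    by apply: measurableT_comp => //; apply: measurable_funB => //; exact: mind.
  exists 2 => x; rewrite normr_id; apply: le_trans (ler_normB _ _) _.
  rewrite (_ : 2 = 1 + 1 :> R)// lerD//.
  by rewrite indicE; case: (_ \in _); rewrite ?normr1 ?normr0.
have da := dev _ _ mpos cuta; have db := dev _ _ mneg cutb.
have iac : P.-integrable setT (EFin \o (fun x => `|c x|)).
  by have := integrable_abse intc; rewrite (_ : (_ \o _)%FUN = (EFin \o (fun x => `|c x|))).
have ia := integrable_bddm iac da; have ib := integrable_bddm iac db.
have ic := integrable_bddm intc (cutoff_bddm cutc).
have bE : bddm (\1_(~` E) : borel X -> R).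
  split; first by apply: measurable_indic; exact: measurableC.
  by exists 1 => x; rewrite indicE; case: (_ \in _); rewrite ?normr1 ?normr0.
have iE := integrable_bddm iac bE.
(* Off E, |c| is c times the difference of the two indicators; on E the left-hand side vanishes. *)
apply: (@le_trans _ _ (\int[P]_x (c x * (ca x - cb x))%:E +
   (\int[P]_x (`|c x| * `|ca x - \1_([set x | 0 < c x] `\` E) x|)%:E +
    \int[P]_x (`|c x| * `|cb x - \1_([set x | c x < 0] `\` E) x|)%:E))%E); last first.
  by apply: leeD => //; rewrite [e in leRHS]splitr EFinD; exact: leeD.
rewrite -[X in (_ <= _ + X)%E]integralD// -integralD//; last exact: integrableD.
apply: le_integral => //; first by apply: integrableD => //; exact: integrableD.
move=> x _; rewrite -!EFinD lee_fin.
have pa := a0 x; have pb := b0 x; rewrite !indicE !in_setD !in_setC.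
have [xE|xE] := boolP (x \in E); rewrite ?andbF ?andbT /=.
  rewrite mulr0 !subr0 (ger0_norm pa) (ger0_norm pb).
  have := ler_norm (- c x); have := ler_norm (c x); rewrite normrN => h1 h2; nra.
have [cp|cn|c00] := ltgtP 0 (c x).
- have -> : (x \in [set x | 0 < c x]) = true by exact: mem_set.
  have -> : (x \in [set x | c x < 0]) = false by apply: memNset => /= ?; lra.
  rewrite subr0 (ger0_norm pb) (gtr0_norm cp).
  have := ler_norm (1%:R - ca x); rewrite distrC => h1; nra.
- have -> : (x \in [set x | c x < 0]) = true by exact: mem_set.
  have -> : (x \in [set x | 0 < c x]) = false by apply: memNset => /= ?; lra.
  rewrite subr0 (ger0_norm pa) (ltr0_norm cn).
  have := ler_norm (1%:R - cb x); rewrite distrC => h1; nra.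
- by rewrite -c00 normr0 !mul0r !addr0.
Qed.

End approximation.

(** * Tent functions on a mesh *)

Section hats.
Context (R : realType).
Implicit Types (s t u : R) (a : nat -> R) (psi : R -> R).

Definition hat u : R := Num.max 0 (1 - `|u|).

(** The derivative of hat off -1, 0 and 1, and zero at these three points. *)
Definition dhat u : R := if -1 < u < 0 then 1 else if 0 < u < 1 then -1 else 0.

Lemma hat_ge0 u : 0 <= hat u. Proof. by rewrite le_max lexx. Qed.

Lemma hat_dist u w : `|hat u - hat w| <= `|u - w|.
Proof.
apply: max_dist_le; first by rewrite subrr normr0.
rewrite (_ : _ - _ = `|w| - `|u|); last by ring.
by apply: le_trans (ler_dist_dist _ _) _; rewrite distrC.
Qed.

Lemma hat_out u : 1 <= `|u| -> hat u = 0.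
Proof. by move=> u1; rewrite /hat max_l// subr_le0. Qed.

Lemma dhat_out u : 1 <= `|u| -> dhat u = 0.
Proof.
rewrite ler_normr => u1; rewrite /dhat; case: ifP => [/andP[? ?]|_].
  by case/orP: u1 => ?; lra.
by case: ifP => // /andP[? ?]; case/orP: u1 => ?; lra.
Qed.

(** The sum is a trapezoid; the induction carries its right flank. *)
Lemma hat_sum_le1 (N : nat) s : \sum_(i < N) hat (s - i%:R) <= 1.
Proof.
have : \sum_(i < N) hat (s - i%:R) <= Num.max 0 (Num.min 1 (N%:R - s)).
  elim: N => [|N IH]; first by rewrite big_ord0 le_max lexx.
  rewrite big_ord_recr/=; apply: le_trans (lerD IH (lexx _)) _.
  rewrite /hat -natr1.
  move: (s - N%:R) (opprB s N%:R) => u uE.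
  have -> : N%:R - s = - u by rewrite uE.
  have -> : N%:R + 1 - s = 1 - u by lra.
  have [u1|u1] := leP u (-1).
    have n1 : 1 <= `|u| by rewrite ler0_norm; lra.
    rewrite (@min_l _ _ 1 (- u)) ?(@min_l _ _ 1 (1 - u)); [|lra|lra].
    by rewrite [X in _ + X]max_l ?addr0// subr_le0.
  have [u0|u0] := ltP u 0.
    rewrite ltr0_norm// (@min_r _ _ 1 (- u)) ?(@min_l _ _ 1 (1 - u)); [|lra|lra].
    rewrite !max_r; lra.
  rewrite ger0_norm// (@min_r _ _ 1 (- u)) ?(@min_r _ _ 1 (1 - u)); [|lra|lra].
  by rewrite (@max_l _ _ 0 (- u)) ?add0r//; lra.
by move=> /le_trans; apply; rewrite ge_max ler01 ge_min lexx.
Qed.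

(** Only the two nodes next to s see s. The closed cell is allowed because phi vanishes at -1 and 1. *)
Lemma sum_two_nodes (phi : R -> R) a (N k : nat) s :
  (forall u, 1 <= `|u| -> phi u = 0) -> k%:R <= s <= k.+1%:R -> (k.+1 < N)%N ->
  \sum_(i < N) a i * phi (s - i%:R) = a k * phi (s - k%:R) + a k.+1 * phi (s - k.+1%:R).
Proof.
move=> phi0 /andP[ks sk] kN; have kN' := ltnW kN.
rewrite (bigD1 (Ordinal kN'))//= (bigD1 (Ordinal kN))/=; last first.
  by rewrite -val_eqE/= gtn_eqF.
rewrite big1 ?addr0// => i /andP[]; rewrite -!val_eqE/= => ik ik1.
rewrite phi0 ?mulr0//; case: (ltngtP i k) ik => // ik _.
  have : i.+1%:R <= k%:R :> R by rewrite ler_nat.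
  by rewrite -natr1 => h; rewrite ger0_norm; lra.
have : k.+2%:R <= i%:R :> R by rewrite ler_nat ltn_neqAle eq_sym ik1.
by rewrite -natr1 => h; rewrite ler0_norm; lra.
Qed.

Lemma is_derive_hat u : u != -1 -> u != 0 -> u != 1 -> is_derive u (1 : R) hat (dhat u).
Proof.
move=> u1 u0 u2.
have [g [dg gu]] : exists g : R -> R, is_derive u (1 : R) g (dhat u) /\
    {near u, hat =1 g}.
  have nearU (p q : R) : p < u -> u < q -> \forall y \near u, p < y < q.
    move=> pu uq; near=> y; apply/andP; split.
      by near: y; exact: lt_nbhsr.
    by near: y; exact: lt_nbhsl.
  have [ul|ul] := ltP u (-1).
    exists (cst 0); rewrite dhat_out; last by rewrite ltr0_norm; lra.
    split; first exact: is_derive_cst.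
    have := nearU (u - 1) (-1) _ ul; rewrite gtrBl ltr01 => /(_ isT).
    by apply: filterS => y /andP[_ y1]; rewrite hat_out// ltr0_norm; lra.
  have [um|um] := ltP u 0.
    have u1' : -1 < u by rewrite lt_neqAle eq_sym u1.
    exists (fun y => 1 + y); split.
      rewrite /dhat u1' um -[X in is_derive _ _ _ X]add0r; exact: is_deriveD.
    have := nearU _ _ u1' um.
    by apply: filterS => y /andP[y0 y1]; rewrite /hat ltr0_norm// opprK max_r//; lra.
  have u0' : 0 < u by rewrite lt_neqAle eq_sym u0.
  have [ur|ur] := ltP u 1.
    exists (fun y => 1 - y); split.
      rewrite /dhat u0' ur [u < 0]ltNge (ltW u0')/= andbF -[X in is_derive _ _ _ X]add0r.
      exact: is_deriveB.
    have := nearU _ _ u0' ur.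
    by apply: filterS => y /andP[y0 y1]; rewrite /hat gtr0_norm// max_r//; lra.
  have ur' : 1 < u by rewrite lt_neqAle eq_sym u2.
  exists (cst 0); rewrite dhat_out; last by rewrite gtr0_norm//.
  split; first exact: is_derive_cst.
  have := nearU _ (u + 1) ur'; rewrite ltrDl ltr01 => /(_ isT).
  by apply: filterS => y /andP[y1 _]; rewrite hat_out// gtr0_norm; lra.
by apply: near_eq_is_derive dg => //; apply: filterS gu.
Unshelve. all: by end_near. Qed.

(** The mesh has nodes (i - m^2) / m for i <= 2 m^2, with m = n.+1: it becomes finer and exhausts
    the line at the same time. In the coordinate mesh_coord n the node i sits at i. *)
Definition mesh_coord (n : nat) t : R := n.+1%:R * t + (n.+1 ^ 2)%:R.
Definition node (n i : nat) : R := (i%:R - (n.+1 ^ 2)%:R) / n.+1%:R.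
Definition nodes (n : nat) : nat := (2 * n.+1 ^ 2).+1.
Definition tent (n i : nat) t : R := hat (mesh_coord n t - i%:R).
(** For kappa the inverse variance, this is the Gaussian divergence of tent n i away from the mesh
    points. *)
Definition tent_div (kappa : R) (n i : nat) t : R :=
  n.+1%:R * dhat (mesh_coord n t - i%:R) - t * kappa * tent n i t.

Lemma mesh_coordE n i t : mesh_coord n t - i%:R = n.+1%:R * (t - node n i).
Proof. by rewrite /mesh_coord /node; field. Qed.

Lemma measurable_dhat : measurable_fun setT dhat.
Proof.
have mb (a b : R) : measurable_fun setT (fun u : R => a < u < b).
  by apply: measurable_and => //; exact: measurable_fun_ltr.
by do 2![apply: measurable_fun_ifT => //].
Qed.

Lemma mesh_cell n t : `|t| < n.+1%:R ->
  exists k, k%:R <= mesh_coord n t < k.+1%:R /\ (k.+1 < nodes n)%N.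
Proof.
rewrite ltr_norml => /andP[t1 t2].
have m0 : (0 : R) < n.+1%:R by [].
have s0 : 0 <= mesh_coord n t.
  by rewrite /mesh_coord natrX; nra.
exists (Num.truncn (mesh_coord n t)); have := truncn_itv s0 => /andP[h1 h2].
split; first by rewrite h1.
rewrite /nodes ltnS -(ltr_nat R); apply: le_lt_trans h1 _.
by rewrite /mesh_coord natrM natrX; nra.
Qed.

(** All mesh points are rational, so one null set contains the exceptional points of every mesh. *)
Lemma irrational_mesh n i (z : int) t : ~ range (ratr : rat -> R) t ->
  mesh_coord n t - i%:R != z%:~R.
Proof.
move=> it; apply/eqP => E; apply: it.
exists ((z%:~R + i%:R - (n.+1 ^ 2)%:R) / n.+1%:R) => //.
rewrite fmorph_div rmorphB rmorphD/= !ratr_nat ratr_int -E /mesh_coord.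
by field.
Qed.

(** The combination of tents with coefficients psi at the nodes is the piecewise linear interpolant of
    psi. Its divergence is the slope on the cell minus t * kappa times the interpolated value. *)
Lemma tent_interpolation kappa psi n t (k : nat) :
  k%:R <= mesh_coord n t < k.+1%:R -> (k.+1 < nodes n)%N ->
  \sum_(i < nodes n) psi (node n i) * tent_div kappa n i t =
  (if k%:R == mesh_coord n t then 0 else n.+1%:R * (psi (node n k.+1) - psi (node n k)))
  - t * kappa * (psi (node n k) * (1 - (mesh_coord n t - k%:R)) +
                 psi (node n k.+1) * (mesh_coord n t - k%:R)).
Proof.
move=> /andP[ks sk] kN; have sk' := ltW sk.
rewrite (_ : \sum_(i < _) _ =
  n.+1%:R * (\sum_(i < nodes n) psi (node n i) * dhat (mesh_coord n t - i%:R)) -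
  t * kappa * (\sum_(i < nodes n) psi (node n i) * hat (mesh_coord n t - i%:R))); last first.
  rewrite !mulr_sumr -sumrB; apply: eq_bigr => i _; rewrite /tent_div /tent; ring.
rewrite (@sum_two_nodes dhat (fun i => psi (node n i)) _ k); [|exact: dhat_out|by rewrite ks|by []].
rewrite (@sum_two_nodes hat (fun i => psi (node n i)) _ k); [|exact: hat_out|by rewrite ks|by []].
move: ks sk; rewrite -natr1; set s := mesh_coord n t; set kr : R := k%:R => ks sk.
have -> : hat (s - kr) = 1 - (s - kr) by rewrite /hat ger0_norm ?subr_ge0// max_r//; lra.
have -> : hat (s - (kr + 1)) = s - kr by rewrite /hat ler0_norm ?max_r//; lra.
congr (_ - _); rewrite /dhat.
have [->|ns] := eqVneq kr s.
  have -> : s - (s + 1) = - 1 by ring.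
  by rewrite subrr !ltxx/= oppr_gt0 ltr10 andbF !mulr0 addr0 mulr0.
have ks' : kr < s by rewrite lt_neqAle ns.
have -> : (-1 < s - kr < 0) = false by apply/negP => /andP[? ?]; lra.
have -> : 0 < s - kr < 1 by apply/andP; split; lra.
have -> : -1 < s - (kr + 1) < 0 by apply/andP; split; lra.
ring.
Qed.

Lemma node_dist n t (k : nat) : k%:R <= mesh_coord n t < k.+1%:R ->
  [/\ node n k <= t, t <= node n k.+1 & n.+1%:R * (node n k.+1 - node n k) = 1 :> R].
Proof.
have m0 : (0 : R) < n.+1%:R by [].
move=> /andP[ks sk]; split.
- by rewrite -subr_ge0 -(pmulr_rge0 _ m0) -mesh_coordE subr_ge0.
- by rewrite -subr_le0 -(pmulr_rle0 _ m0) -mesh_coordE subr_le0 ltW.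
- by rewrite /node -natr1; field.
Qed.

(** A chord whose endpoints straddle t and close up on it has slope tending to the derivative at t,
    although neither endpoint is t. *)
Lemma tent_div_cvg kappa psi (L : R) t : 0 <= L ->
  (forall x y, `|psi x - psi y| <= L * `|x - y|) ->
  derivable psi t 1 -> ~ range (ratr : rat -> R) t ->
  (fun n => \sum_(i < nodes n) psi (node n i) * tent_div kappa n i t) @ \oo -->
    derive1 psi t - t * kappa * psi t.
Proof.
move=> L0 psiL dpsi irr; apply/cvgrPdist_le => e e0; set D := derive1 psi t.
have e2 : 0 < e / 2 by rewrite divr_gt0.
have [d /= d0 dD] : \forall h \near (0 : R)^', `|D - h^-1 *: (psi (h + t) - psi t)| <= e / 2.
  have : h^-1 *: (psi (h + t) - psi t) @[h --> (0 : R)^'] --> D.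
    rewrite /D derive1E (_ : (fun h : R => _) =
      (fun h : R => h^-1 *: ((psi \o shift t) (h *: (1 : R)) - psi t))); first exact: dpsi.
    by apply/funext => h /=; rewrite [h *: _]mulr1.
  by move=> /cvgrPdist_le; apply.
have lin u : `|t - u| < d -> `|psi u - psi t - D * (u - t)| <= e / 2 * `|u - t|.
  move=> ud; have [->|ut] := eqVneq u t; first by rewrite !subrr mulr0 subrr normr0 mulr0.
  have h0 : u - t != 0 by rewrite subr_eq0.
  have := dD (u - t); rewrite /= sub0r opprB => /(_ ud h0); rewrite subrK.
  have -> : psi u - psi t - D * (u - t) = - ((u - t) * (D - (u - t)^-1 *: (psi u - psi t))).
    by rewrite /GRing.scale/=; field.
  by rewrite normrN normrM => H; rewrite mulrC ler_wpM2r.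
near=> n.
have m0 : (0 : R) < n.+1%:R by [].
have nt : `|t| < n.+1%:R.
  by apply: (@lt_trans _ _ n%:R); [near: n; exact: nbhs_infty_gtr|rewrite ltr_nat].
have nd : n.+1%:R^-1 < d by near: n; exact: near_infty_natSinv_lt (PosNum d0).
have nk : `|t * kappa| * L <= e / 2 * n%:R.
  by rewrite [leRHS]mulrC -ler_pdivrMr//; near: n; exact: nbhs_infty_ger.
have {}nk : `|t * kappa| * L <= e / 2 * n.+1%:R.
  by apply: le_trans nk _; rewrite ler_wpM2l ?ler_nat// ltW.
have [k [ks kN]] := mesh_cell nt.
rewrite (tent_interpolation kappa psi ks kN) ifN; last first.
  have := irrational_mesh n k 0 irr; apply: contraNneq => <-; rewrite subrr//.
have [u0 u1 u01] := node_dist ks; move: (mesh_coordE n k t) => sE.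
move: ks; rewrite -natr1 => /andP[ks sk].
move: (node n k) (node n k.+1) u0 u1 u01 sE => a b ta tb ab sE.
set th := mesh_coord n t - k%:R in sE *.
have th0 : 0 <= th by rewrite subr_ge0.
have th1 : th <= 1 by rewrite /th; lra.
have invm : n.+1%:R^-1 = b - a.
  by apply: (mulfI (lt0r_neq0 m0)); rewrite ab mulfV// lt0r_neq0.
rewrite invm in nd.
have la := lin a; have lb := lin b.
have ha : `|t - a| < d by rewrite ger0_norm; lra.
have hb : `|t - b| < d by rewrite ler0_norm; lra.
move: (la ha) (lb hb); rewrite (ler0_norm (x := a - t)) ?(ger0_norm (x := b - t)); [|lra|lra] => {la lb}.
have pa := psiL t a; have pb := psiL t b.
rewrite (ger0_norm (x := t - a)) ?subr_ge0// in pa.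
rewrite (ler0_norm (x := t - b)) ?subr_le0// in pb.
move: (n.+1%:R) m0 ab nk sE => m m0 ab nk sE {ha hb nd invm nt kN ks sk lin dD}.
set A := psi a - psi t - D * (a - t); set B := psi b - psi t - D * (b - t).
move=> lA lB.
rewrite (_ : _ - _ = - (m * (B - A)) + t * kappa * ((1 - th) * (psi a - psi t) + th * (psi b - psi t))); last first.
  have E : D = m * (b - a) * D by rewrite ab mul1r.
  by rewrite {1}E /A /B; ring.
apply: le_trans (ler_normD _ _) _; rewrite normrN [e in leRHS]splitr; apply: lerD.
  rewrite normrM (gtr0_norm m0); apply: (@le_trans _ _ (m * (e / 2 * (b - a)))).
    rewrite ler_pM2l//; apply: le_trans (ler_normB _ _) _; lra.
  by rewrite mulrCA ab mulr1.
rewrite normrM; apply: (@le_trans _ _ (`|t * kappa| * (L / m))).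
  rewrite ler_wpM2l//; apply: le_trans (ler_normD _ _) _.
  rewrite !normrM (ger0_norm th0) (ger0_norm (x := 1 - th)) ?subr_ge0//.
  have -> : L / m = L * (b - a) by rewrite -[m^-1]mulr1 -ab mulKf// lt0r_neq0.
  rewrite distrC in pa; rewrite distrC in pb.
  have p1 : `|psi a - psi t| <= L * (b - a) by apply: le_trans pa _; rewrite ler_wpM2l//; lra.
  have p2 : `|psi b - psi t| <= L * (b - a) by apply: le_trans pb _; rewrite ler_wpM2l//; lra.
  rewrite [leRHS](_ : _ = (1 - th) * (L * (b - a)) + th * (L * (b - a))); last by ring.
  by apply: lerD; rewrite ler_wpM2l// subr_ge0.
by rewrite mulrA ler_pdivrMr.
Unshelve. all: by end_near. Qed.

(** The slopes of the interpolant are at most L. The factor t * kappa is controlled because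
    the interpolant vanishes within one cell outside the support of psi, that is for |t| >= M + 1. *)
Lemma tent_div_bound kappa psi (L M : R) n t :
  (forall x y, `|psi x - psi y| <= L * `|x - y|) -> (forall x, `|psi x| <= 1) ->
  (forall x, psi x != 0 -> `|x| <= M) -> M + 1 <= n.+1%:R -> 0 <= M -> 0 <= L ->
  `|\sum_(i < nodes n) psi (node n i) * tent_div kappa n i t| <= L + (M + 1) * `|kappa|.
Proof.
move=> psiL psi1 psiM nM M0 L0; have m0 : (0 : R) < n.+1%:R by [].
have [tM|tM] := ltP `|t| (M + 1); last first.
  rewrite big1 ?normr0 ?addr_ge0// ?mulr_ge0 ?addr_ge0//.
  move=> i _; have [->|/psiM nz] := eqVneq (psi (node n i)) 0; first by rewrite mul0r.
  have far : 1 <= `|mesh_coord n t - i%:R|.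
    rewrite mesh_coordE normrM gtr0_norm//.
    have := lerB_dist t (node n i); have : (1 : R) <= n.+1%:R by rewrite ler1n.
    nra.
  by rewrite /tent_div /tent hat_out// dhat_out// !mulr0 subrr mulr0.
have [k [ks kN]] := mesh_cell (lt_le_trans tM nM).
rewrite (tent_interpolation kappa psi ks kN).
have [u0 u1 u01] := node_dist ks.
move: ks; rewrite -natr1 => /andP[ks sk].
apply: le_trans (ler_normB _ _) _; apply: lerD.
  case: ifP => _; first by rewrite normr0.
  rewrite normrM gtr0_norm//; apply: (@le_trans _ _ (n.+1%:R * (L * (node n k.+1 - node n k)))).
    rewrite ler_pM2l//; apply: le_trans (psiL _ _) _; rewrite ger0_norm//; lra.
  by rewrite mulrCA u01 mulr1.
rewrite !normrM -[leRHS]mulr1; apply: ler_pM => //.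
  by rewrite ler_wpM2r// ltW.
set th := mesh_coord n t - k%:R.
have th0 : 0 <= th by rewrite subr_ge0.
have th1 : th <= 1 by rewrite /th; lra.
apply: le_trans (ler_normD _ _) _.
rewrite !normrM (ger0_norm th0) (ger0_norm (x := 1 - th)) ?subr_ge0//.
have := psi1 (node n k); have := psi1 (node n k.+1); nra.
Qed.

Lemma bddm_tent_div kappa n i : bddm (tent_div kappa n i : R -> R).
Proof.
have mc : measurable_fun setT (fun t : R => mesh_coord n t - i%:R).
  by apply: measurable_funB => //; apply: measurable_funD => //; apply: measurable_funM.
have chat : continuous hat.
  by apply: (lipschitz_continuous (L := 1)) => x y; rewrite mul1r; exact: hat_dist.
have hat1 u : `|hat u| <= 1.
  by rewrite ger0_norm ?hat_ge0// /hat ge_max ler01 gerBl normr_ge0.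
have dhat1 u : `|dhat u| <= 1.
  by rewrite /dhat; case: ifP => _; [|case: ifP => _]; rewrite ?normrN ?normr1 ?normr0.
split.
  apply: measurable_funB.
    by apply: measurable_funM => //; apply: (measurableT_comp measurable_dhat).
  apply: measurable_funM; first by apply: measurable_funM.
  by apply: (measurableT_comp (f := hat)) => //; exact: continuous_measurable_fun.
exists (n.+1%:R + (`|node n i| + 1) * `|kappa|) => t.
apply: le_trans (ler_normB _ _) _; apply: lerD.
  by rewrite normrM ger0_norm// ler_piMr.
rewrite normrM [`|t * kappa|]normrM /tent.
have [far|near_] := leP 1 `|mesh_coord n t - i%:R|.
  by rewrite hat_out// normr0 mulr0 mulr_ge0// addr_ge0.
rewrite -[leRHS]mulr1; apply: ler_pM => //.
rewrite ler_wpM2r//; rewrite mesh_coordE normrM ger0_norm// in near_.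
have := ler_distD 0 t (node n i); rewrite !subr0 sub0r normrN => h1.
have := lerB_dist t (node n i); have : (1 : R) <= n.+1%:R by rewrite ler1n.
have := normr_ge0 (t - node n i); nra.
Qed.

End hats.

Section tube.
Context (R : realType) (X : normedModType R).

(** Distances to a point outside O pass from the nonvanishing set of G to its closure. *)
Lemma lip_c_of_distance (O : set X) (G : X -> R^o) (L M r d : R) : 0 < L -> 0 < d ->
  (forall x y, `|G x - G y| <= L * `|x - y|) -> (forall x, `|G x| <= M) ->
  (forall x, G x != 0 -> `|x| <= r) ->
  (forall x z, G x != 0 -> ~ O z -> d <= `|x - z|) -> lip_c O G.
Proof.
move=> L0 d0 GL GM Gr Gd.
have cl x z : closure [set x | G x != 0] x -> ~ O z -> d <= `|x - z|.
  move=> cx Oz; apply/ler_addgt0Pr => e e0.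
  have [y [/= Gy]] := cx _ (nbhsx_ballx x e e0).
  rewrite -ball_normE/= => xy; apply: le_trans (Gd _ _ Gy Oz) _.
  have := ler_distD x y z; rewrite (distrC y x); lra.
split.
- by exists M; split; [exact: num_real|move=> N MN x _; exact: le_trans (GM x) (ltW MN)].
- by apply/lipschitzP; exists L.
- exists (r + 1); split; first exact: num_real.
  move=> N rN x cx /=.
  have [y [/= Gy]] := cx _ (nbhsx_ballx x 1 ltr01).
  rewrite -ball_normE/= => xy; have := Gr _ Gy.
  have := lerB_dist x y; lra.
- move=> x cx; apply: contrapT => Ox; have := cl _ _ cx Ox.
  by rewrite subrr normr0 leNgt d0.
- by exists d.
Qed.

Definition leaves (O : set X) (h : X) (a b : R) : set X :=
  [set w | exists2 t, a <= t <= b & ~ O (w + t *: h)].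

(** By compactness a segment contained in the open set O stays at a positive distance from the
    complement. *)
Lemma closed_leaves (O : set X) h a b : a <= b -> open O -> closed (leaves O h a b).
Proof.
move=> ab oO; rewrite -[leaves _ _ _ _]setCK; apply: open_closedC.
rewrite openE => w nw; have cO : closed (~` O) by exact: open_closedC.
pose phi t := cdist (~` O) (w + t *: h).
have cphi : continuous phi.
  move=> t; apply: (@continuous_comp _ _ _ (fun t : R => w + t *: h) (cdist (~` O) : X -> R^o)).
    by apply: cvgD; [exact: cvg_cst|apply: cvgZr_tmp; exact: cvg_id].
  apply: (lipschitz_continuous (L := 1)) => x y.
  by rewrite mul1r; exact: cdist_lip.
have [c cab cmin] := EVT_min ab (continuous_subspaceT cphi).
have p0 : 0 < phi c.
  by apply: cdist_gt0 => // nO; apply: nw; exists c => //; rewrite in_itv/= in cab.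
apply/nbhs_ballP; exists (phi c) => //= w' ww' [t tab nO].
have := cmin t; rewrite in_itv/= => /(_ tab).
have := @cdist_le _ _ (~` O) (w + t *: h) _ nO.
rewrite -/(phi t) opprD addrACA subrr addr0 => h1 h2.
by move: ww'; rewrite -ball_normE/= => h3; lra.
Qed.

End tube.

(** * Gluing test functions on lines *)

Section tent_calculus.
Context (R : realType).
Implicit Types (t : R) (a : nat -> R).

Lemma derive1_tents a n t : ~ range (ratr : rat -> R) t ->
  derive1 (fun s => \sum_(i < nodes n) a i * tent n i s) t =
  \sum_(i < nodes n) a i * (n.+1%:R * dhat (mesh_coord n t - i%:R)).
Proof.
move=> irr.
have dt i : is_derive t (1 : R) (fun s => a i * tent n i s) (a i * (n.+1%:R * dhat (mesh_coord n t - i%:R))).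
  have da : is_derive t (1 : R) (fun s => mesh_coord n s - i%:R) n.+1%:R.
    rewrite (_ : (fun s => _) = (n.+1%:R *: (id : R -> R)) + cst ((n.+1 ^ 2)%:R - i%:R)); last first.
      by apply/funext => s; rewrite /mesh_coord -addrA.
    rewrite -[X in is_derive _ _ _ X]addr0 -[X in is_derive _ _ _ (X + _)]mulr1.
    exact: is_deriveD.
  have dh : is_derive (mesh_coord n t - i%:R) (1 : R) (@hat R) (dhat (mesh_coord n t - i%:R)).
    by apply: is_derive_hat; have := irrational_mesh n i _ irr;
      [move/(_ (-1))|move/(_ 0)|move/(_ 1)].
  have dc := @is_derive1_comp _ (@hat R) (fun s => mesh_coord n s - i%:R) _ _ _ dh da; rewrite mulrC in dc.
  exact: (is_deriveZ (a i) dc).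
rewrite derive1E (_ : (fun s => _) = \sum_(i < nodes n) (fun s => a i * tent n i s)); last first.
  by apply/funext => s; rewrite fct_sumE.
have ds := is_derive_sum (fun i : 'I_(nodes n) => dt i).
by rewrite (derive_val (is_derive := ds)).
Qed.

Lemma ae_irrational : {ae @lebesgue_measure R, forall t, ~ range (ratr : rat -> R) t}.
Proof.
have cQ : countable (range (ratr : rat -> R)) by apply: sub_countable (card_image_le _ _) _; exact: countableP.
exists (range (ratr : rat -> R)); split.
- exact: countable_measurable.
- exact: countable_lebesgue_measure0.
- by move=> t /= /contrapT.
Qed.

Lemma tents_le1 a n t : (forall i, `|a i| <= 1) -> `|\sum_(i < nodes n) a i * tent n i t| <= 1.
Proof.
move=> a1; apply: le_trans (ler_norm_sum _ _ _) _.
apply: le_trans (hat_sum_le1 (nodes n) (mesh_coord n t)); apply: ler_sum => i _.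
by rewrite normrM (ger0_norm (hat_ge0 _)) ler_piMl// hat_ge0.
Qed.

End tent_calculus.

Lemma le_limn_einf (R : realType) (a u : (\bar R)^nat) (l : \bar R) :
  a @ \oo --> l -> (\forall n \near \oo, (a n <= u n)%E) -> (l <= limn_einf u)%E.
Proof.
move=> al [n0 _ au]; have [<- _] := cvg_limn_einf_sup al.
rewrite !limn_einf_lim; apply: lee_lim; [exact: is_cvg_einfs|exact: is_cvg_einfs|].
exists n0 => // n /= n0n; apply: le_ereal_inf_tmp => _ [k /= nk <-].
apply: le_trans (au k _); last exact: leq_trans nk.
by apply: ereal_inf_lbound; exists k.
Qed.

Lemma measurable_limn_einf d (T : measurableType d) (R : realType) (f : (T -> \bar R)^nat) :
  (forall n, measurable_fun setT (f n)) ->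
  measurable_fun setT (fun x => limn_einf (f ^~ x)).
Proof.
move=> mf; apply: measurableT_comp => //.
apply: (measurable_fun_limn_esup (f := fun n x => - f n x)%E) => n.
exact: measurableT_comp.
Qed.

Lemma limn_einf_le_ub (R : realType) (u : (\bar R)^nat) (c : \bar R) :
  (forall n, (u n <= c)%E) -> (limn_einf u <= c)%E.
Proof.
move=> uc; rewrite limn_einf_lim; apply: lime_le; first exact: is_cvg_einfs.
by apply: nearW => n; apply: le_trans (uc n); apply: ereal_inf_lbound; exists n => /=.
Qed.

Section lower_bound.
Context (R : realType) (X : normedModType R) (sepX : separable_space X)
  (gamma : probability (borel X) R) (Q : {linear dual X -> X})
  (gaussX : centred_gaussian gamma Q) (ndQ : nondegenerate_cov Q)
  (h : X) (hh : dual X) (hQ : h = Q hh) (h0 : h != 0)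
  (O : set X) (openO : open O) (f : X -> R)
  (intf : gamma.-integrable O (EFin \o f)).

Let P1 : probability R R := law_coord gamma h hh.
Let P2 : probability (borel X) R := law_perp sepX gamma h hh.
Let hh0 : 0 < hh h. Proof. exact: (hh_h_gt0 ndQ hQ h0). Qed.

Let F z : R := (f \_ O) (recombine h z).

Let intF : (P1 \x P2)%E.-integrable setT (EFin \o F).
Proof.
exact: (gaussian_integrable sepX gaussX ndQ hQ h0 (integrable_restrict_open openO intf)).
Qed.

(** The pairing of the section of f with the divergence of one tent. It is finite for almost every y;
    fine supplies a value elsewhere. *)
Definition coeff n i (y : borel X) : R :=
  fine (\int[P1]_t (F (t, y) * tent_div (hh h) n i t)%:E)%E.

Lemma integrable_coeff n i : P2.-integrable setT (EFin \o coeff n i).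
Proof.
pose P12 : probability (R * borel X)%type R := (P1 \x P2)%E.
have I : P12.-integrable setT (fun z => (F z * tent_div (hh h) n i z.1)%:E).
  apply: integrable_bddm; first exact: intF.
  exact: (bddm_comp (bddm_tent_div (hh h) n i) measurable_fst).
have mI := measurable_int _ I.
have mc : measurable_fun setT (coeff n i).
  apply: (measurableT_comp (f := fine)) => //.
  exact: (measurable_fubini_G I).
apply/integrableP; split; first exact/measurable_EFinP.
apply: le_lt_trans ((integrable21ltyP P1 P2 mI).1 I).
apply: ge0_le_integral => //.
- by apply: measurableT_comp => //; exact/measurable_EFinP.
- apply: (@measurable_fun_fubini_tonelli_G _ _ _ _ _ P1 (fun z => `|(F z * tent_div (hh h) n i z.1)%:E|)%E) => //.
  exact: measurableT_comp.
move=> y _; apply: le_trans (le_abse_integral _ _ _) => //.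
  by rewrite /coeff /=; case: (integral _ _ _) => [r| |] //=; rewrite ?leey.
exact: measurableT_comp mI (pair2_measurable y).
Qed.

(** Tents centred at node n i are supported in the interval of radius 1 / n.+1 around it; off this
    closed set the line through y can carry that tent inside O. *)
Definition window n i : set X :=
  leaves O h (node R n i - n.+1%:R^-1) (node R n i + n.+1%:R^-1).

Let closed_window n i : closed (window n i).
Proof. by apply: closed_leaves => //; rewrite lerD2l (@le_trans _ _ 0) ?oppr_le0. Qed.

(** The best value of the pairing with f along the line through y, among combinations with coefficients
    in [-1, 1] of the tents that fit inside O. *)
Definition sections_sum n (y : borel X) : R :=
  \sum_(i < nodes n) `|coeff n i y| * \1_(~` window n i) y.

Let integrable_window_coeff n i :
  P2.-integrable setT (fun y => (`|coeff n i y| * \1_(~` window n i) y)%:E).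
Proof.
have /integrable_abse Ic := integrable_coeff n i.
apply: (@integrable_bddm _ _ _ P2 (fun y => `|coeff n i y|)) => //.
split.
  by apply: measurable_indic; apply: measurableC; exact: closed_borel.
by exists 1 => y; rewrite indicE; case: (_ \in _); rewrite ?normr1 ?normr0.
Qed.

Lemma measurable_sections_sum n : measurable_fun setT (EFin \o sections_sum n).
Proof.
rewrite (_ : EFin \o _ = (fun y => \sum_(i < nodes n) (`|coeff n i y| * \1_(~` window n i) y)%:E)%E); last first.
  by apply/funext => y; rewrite /= sumEFin.
apply: emeasurable_sum => i _.
exact: (measurable_int _ (integrable_window_coeff n i)).
Qed.

Lemma sections_sum_ge0 n y : 0 <= sections_sum n y.
Proof. by apply: sumr_ge0 => i _; rewrite mulr_ge0. Qed.

Let good_section (y : borel X) := hh y = 0 /\ P1.-integrable setT (fun t => (F (t, y))%:E).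

Let good_ae : {ae P2, forall y, good_section y}.
Proof.
apply: filterI; last exact: (ae_integrable2 intF).
have mK : measurable [set y : borel X | hh y = 0].
  by have := measurable_dual hh measurableT (measurable_set1 0); rewrite setTI.
exists (~` [set y : borel X | hh y = 0]); split => //; first exact: measurableC.
by rewrite probability_setC// (law_perp_ker _ _ ndQ hQ h0) subee.
Qed.

Let coeffE y n i : good_section y ->
  (coeff n i y)%:E = (\int[P1]_t (F (t, y) * tent_div (hh h) n i t)%:E)%E.
Proof.
move=> [_ Iy]; rewrite /coeff fineK//.
by apply: integrable_fin_num => //; apply: integrable_bddm => //; exact: bddm_tent_div.
Qed.

Let integral_tents y n (a : nat -> R) : good_section y ->
  (\int[P1]_t (F (t, y) * \sum_(i < nodes n) a i * tent_div (hh h) n i t)%:E =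
   (\sum_(i < nodes n) a i * coeff n i y)%:E)%E.
Proof.
move=> gy; have [_ Iy] := gy.
have It i := integrable_bddm Iy (bddm_tent_div (hh h) n i).
transitivity (\int[P1]_t \sum_(i < nodes n) ((a i)%:E * (F (t, y) * tent_div (hh h) n i t)%:E))%E.
  apply: eq_integral => t _; rewrite mulr_sumr -sumEFin; apply: eq_bigr => i _.
  by rewrite -EFinM mulrCA.
rewrite integral_sum//; last by move=> i; exact: integrableZl.
rewrite -sumEFin; apply: eq_bigr => i _.
by rewrite integralZl// -coeffE.
Qed.

(** The interpolants of an admissible psi on finer meshes have divergences converging boundedly, almost
    everywhere by Rademacher's theorem, to that of psi. Their coefficients are at most 1, and since
    the support of psi keeps its distance from the complement of O, eventually only tents that fit
    inside O occur, so the pairing is bounded by sections_sum. *)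
Lemma Vgamma1_le_liminf y : good_section y ->
  (Vgamma1 P1 (hh h)^-1 (section_fun f h y) (section_set O h y) <=
   limn_einf (fun n => (sections_sum n y)%:E))%E.
Proof.
move=> gy; have [hy Iy] := gy; apply: ge_ereal_sup => _ [psi [psiU psi1] <-].
have [_ /lipschitzP[L L0 psiL] /bounded_set_bound[M M0 psiM] psiO [d d0 psid]] := psiU.
have supp t : psi t != 0 -> closure [set x | psi x != 0] t by move=> ?; exact: subset_closure.
have {}psi1 t : `|psi t| <= 1.
  by have [->|/supp/psiO/psi1//] := eqVneq (psi t) 0; rewrite normr0.
have psiM' t : psi t != 0 -> `|t| <= M by move=> /supp/psiM.
have mpsi : measurable_fun setT (psi : R -> R).
  by apply: continuous_measurable_fun; exact: lipschitz_continuous psiL.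
have mdpsi : measurable_fun setT (derive1 psi : R -> R).
  rewrite (_ : derive1 psi = (fun t => 'D_1 psi t)); last by apply/funext => t; rewrite derive1E.
  apply: (measurable_derive (X := R) (phi := id : R -> R)).
    exact: lipschitz_continuous psiL.
  by move=> g cg; exact: continuous_measurable_fun.
have mF := measurable_int _ Iy.
have mFy : measurable_fun setT (fun t => F (t, y)) by exact/measurable_EFinP.
pose g n t := F (t, y) * \sum_(i < nodes n) psi (node R n i) * tent_div (hh h) n i t.
apply: (@le_limn_einf _ (fun n => \int[P1]_t (g n t)%:E)%E).
  rewrite integral_restrictM.
  (* Meshes that do not yet reach past the support escape the uniform bound; they are skipped. *)
  pose n0 := Num.truncn (M + 1).
  have n0M : M + 1 <= n0.+1%:R by apply: ltW; exact: truncnS_gt.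
  rewrite -(cvg_shiftn n0) /=.
  pose B := L + (M + 1) * `|hh h|.
  have [|||||_ _ C] := @dominated_convergence _ _ _ P1 setT measurableT
     (fun n t => (g (n + n0)%N t)%:E)
     (fun t => (F (t, y) * (derive1 psi t - t * hh h * psi t))%:E)
     (fun t => `|F (t, y) * B|%:E).
  - move=> n; apply/measurable_EFinP; apply: measurable_funM => //.
    apply: measurable_sum => i; apply: measurable_funM => //.
    by have [] := bddm_tent_div (hh h) (n + n0) i.
  - apply/measurable_EFinP; apply: measurable_funM => //; apply: measurable_funB => //.
    by apply: measurable_funM => //; apply: measurable_funM.
  - have dpsi : {ae P1, forall t, derivable psi t 1}.
      apply: (law_coord_ae gaussX ndQ hQ h0); apply: derivable_lipschitz.
      by apply/lipschitzP; exists L.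
    have irr := law_coord_ae gaussX ndQ hQ h0 (@ae_irrational R).
    apply: filterS2 dpsi irr => t dt it _.
    apply: cvg_EFin; first exact: nearW.
    apply: (cvg_comp (fun n => (n + n0)%N) (fun n => g n t)); first exact: cvg_addnr.
    apply: cvgMl_tmp; exact: tent_div_cvg (ltW L0) psiL dt it.
  - have bB : bddm (cst B : R -> R) by split => //; exists `|B|.
    have := integrable_abse (integrable_bddm Iy bB).
    by rewrite (_ : (_ \o _)%FUN = (fun t => `|F (t, y) * B|%:E)).
  - apply/aeW => t n _ /=; rewrite lee_fin !normrM ler_wpM2l//.
    have B0 : 0 <= B by rewrite addr_ge0 ?mulr_ge0 ?addr_ge0// ltW.
    rewrite (ger0_norm B0); apply: (@tent_div_bound R (hh h) psi L M) => //.
    + by apply: le_trans n0M _; rewrite ler_nat ltnS leq_addl.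
    + exact: ltW.
    + exact: ltW.
  rewrite (_ : integral _ _ _ = \int[P1]_t (F (t, y) * (derive1 psi t - t * hh h * psi t))%:E)%E//.
  by apply: eq_integral => t _; rewrite /gauss_div1 invrK.
near=> n; rewrite /g (integral_tents n (fun i => psi (node R n i)) gy) lee_fin /sections_sum; apply: ler_sum => i _.
have nd : n.+1%:R^-1 < d by near: n; exact: near_infty_natSinv_lt (PosNum d0).
have [->|nz] := eqVneq (psi (node R n i)) 0; first by rewrite mul0r mulr_ge0.
rewrite indicE mem_set ?mulr1.
  by apply: le_trans (ler_norm _) _; rewrite normrM ler_piMl.
move=> [t /andP[t1 t2] Ot]; have := psid _ _ (supp _ nz) Ot.
apply/negP; rewrite -ltNge; apply: le_lt_trans nd.
move: (n.+1%:R^-1) (node R n i) t1 t2 => q v t1 t2.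
by rewrite ler_norml; apply/andP; split; lra.
Unshelve. all: by end_near. Qed.

(** Choosing the sign of coeff n i as coefficient of the tent i on each line would realise
    sections_sum, but must be done regularly in y. Lipschitz cutoffs chi i approximate these signs off the
    window, and G x = sum of chi i (perpendicular part of x) * tent n i (coordinate of x) is
    an admissible test function: tents sum to at most 1, and where chi i is nonzero the whole support of the
    tent stays at a positive distance from the complement of O. *)
Lemma sections_sum_le_variation n :
  (\int[P2]_y (sections_sum n y)%:E <= Vgamma gamma h hh f O)%E.
Proof.
apply/lee_addgt0Pr => e e0.
have m0 : (0 : R) < n.+1%:R by [].
pose e1 := e / (nodes n)%:R.
have e10 : 0 < e1 by rewrite divr_gt0.
have /choice[chi Hchi] : forall i, exists chi : X -> R^o, cutoff (window n i) chi /\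
  (\int[P2]_y (`|coeff n i y| * \1_(~` window n i) y)%:E <=
   \int[P2]_y (coeff n i y * chi y)%:E + e1%:E)%E.
  move=> i; have [chi c1 c2] := cutoff_approx (integrable_coeff n i) (@closed_window n i) e10.
  by exists chi.
pose crd x : R := hh x / hh h.
pose G x : R^o := \sum_(i < nodes n) chi i (x - proj_h h hh x) * tent n i (crd x).
have [Kh Kh0 hK] := dual_bound hh.
pose Kc := Kh / hh h.
have Kc0 : 0 < Kc by rewrite divr_gt0.
have crdL x z : `|crd x - crd z| <= Kc * `|x - z|.
  rewrite /crd /Kc -mulrBl -dualBr normrM normfV (gtr0_norm hh0) mulrAC.
  by rewrite ler_pM2r ?invr_gt0.
have prjL x z : `|(x - proj_h h hh x) - (z - proj_h h hh z)| <= (1 + Kc * `|h|) * `|x - z|.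
  rewrite /proj_h -/(crd x) -/(crd z).
  rewrite (_ : _ - _ = (x - z) - (crd x - crd z) *: h); last first.
    by rewrite scalerBl !opprD !opprK addrACA.
  apply: le_trans (ler_normB _ _) _; rewrite mulrDl mul1r lerD2l normrZ mulrAC.
  by rewrite ler_wpM2r.
have tentL i (s t : R) : `|tent n i s - tent n i t| <= n.+1%:R * `|s - t|.
  apply: le_trans (hat_dist _ _) _; rewrite !mesh_coordE -mulrBr normrM ger0_norm//.
  by rewrite opprB addrA subrK.
have tent1 i (t : R) : `|tent n i t| <= 1.
  by rewrite ger0_norm ?hat_ge0// /tent /hat ge_max ler01 gerBl normr_ge0.
have GL : exists2 L : R, 0 < L & forall x z, `|G x - G z| <= L * `|x - z|.
  have /choice[L HL] : forall i, exists L : R, 0 < L /\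
     forall x z, `|chi i x - chi i z| <= L * `|x - z|.
    by move=> i; have [[[L L0 cL] _ _ _] _] := Hchi i; exists L.
  pose Li i := L i * (1 + Kc * `|h|) + n.+1%:R * Kc.
  exists (1 + \sum_(i < nodes n) Li i).
    rewrite ltr_wpDr//; apply: sumr_ge0 => i _.
    have [/ltW L0 _] := HL i; have Kc0' := ltW Kc0.
    by apply: addr_ge0; apply: mulr_ge0 => //; apply: addr_ge0 => //; exact: mulr_ge0.
  move=> x z; rewrite /G -sumrB mulrDl mul1r; apply: le_trans (ler_norm_sum _ _ _) _.
  apply: (@le_trans _ _ (\sum_(i < nodes n) Li i * `|x - z|)); last first.
    by rewrite mulr_suml lerDr.
  apply: ler_sum => i _; have [L0 cL] := HL i; have [[_ c1 _ _] _] := Hchi i.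
  set px := x - _; set pz := z - _.
  rewrite (_ : _ - _ = (chi i px - chi i pz) * tent n i (crd x) +
    chi i pz * (tent n i (crd x) - tent n i (crd z))); last by ring.
  apply: le_trans (ler_normD _ _) _; rewrite !normrM /Li mulrDl; apply: lerD.
    apply: (@le_trans _ _ `|chi i px - chi i pz|); first by rewrite ler_piMr ?tent1.
    apply: le_trans (cL _ _) _; rewrite -mulrA ler_pM2l//; exact: prjL.
  apply: (@le_trans _ _ `|tent n i (crd x) - tent n i (crd z)|); first by rewrite ler_piMl.
  by apply: le_trans (tentL _ _ _) _; rewrite -mulrA ler_pM2l.
have G1 x : `|G x| <= 1.
  by apply: (tents_le1 (a := fun i => chi i (x - proj_h h hh x))) => i; have [[]] := Hchi i.
have Gnz x : G x != 0 -> exists i : 'I_(nodes n), chi i (x - proj_h h hh x) != 0 /\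
    `|crd x - node R n i| < n.+1%:R^-1.
  move=> Gx; apply: contrapT => /forallNP H; move/eqP: Gx; apply.
  rewrite /G big1// => i _; have /not_andP[/negP|] := H i; first by rewrite negbK => /eqP->; rewrite mul0r.
  move=> /negP; rewrite -leNgt => far; rewrite /tent hat_out ?mulr0//.
  by rewrite mesh_coordE normrM ger0_norm// -ler_pdivrMl// mulr1.
have GO : lip_c O G.
  have [L L0 HL] := GL.
  have Hr : forall i : 'I_(nodes n), \forall r \near +oo%R, forall x : X, chi i x != 0 -> `|x| <= r.
    move=> i; have [[_ _ [r Hr] _] _] := Hchi i.
    near=> r' => x /Hr/le_trans; apply; near: r'; apply: nbhs_pinfty_ge; exact: num_real.
  have Hd : forall i : 'I_(nodes n), \forall d \near (0 : R)^'+, forall x e : X,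
      chi i x != 0 -> window n i e -> d <= `|x - e|.
    move=> i; have [[_ _ _ [d d0 Hd]] _] := Hchi i.
    near=> d' => x e' cx we; apply: le_trans (Hd _ _ cx we).
    by near: d'; exact: nbhs_right_le.
  have [r Hr'] : exists r : R, forall i : 'I_(nodes n), forall x : X, chi i x != 0 -> `|x| <= r.
    exact: filter_ex (filter_forall _ Hr).
  have [d [d0 Hd']] : exists d : R, 0 < d /\ forall i : 'I_(nodes n), forall x e : X,
      chi i x != 0 -> window n i e -> d <= `|x - e|.
    apply: (@filter_ex _ ((0 : R)^'+)); apply: filterI; first exact: nbhs_right_gt.
    exact: (filter_forall _ Hd).
  apply: (lip_c_of_distance (L := L) (M := 1) (d := d)
    (r := r + (\sum_(i < nodes n) `|node R n i| + 1) * `|h|)) => //.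
    move=> x /Gnz[i [cx nx]].
    rewrite -[x in leLHS](subrK (proj_h h hh x)); apply: le_trans (ler_normD _ _) _.
    apply: lerD; first exact: Hr' cx.
    rewrite normrZ ler_wpM2r// -/(crd x).
    have : `|node R n i| <= \sum_(i < nodes n) `|node R n i|.
      by rewrite (bigD1 i)//= lerDl sumr_ge0.
    have : n.+1%:R^-1 <= 1 :> R by rewrite invf_le1// ler1n.
    have := lerB_dist (crd x) (node R n i).
    by move: (n.+1%:R^-1) nx => q nx; lra.
  move=> x z /Gnz[i [cx nx]] Oz.
  (* The point z - crd x h belongs to the window, since moving it by crd x h leaves O at z. *)
  have := Hd' i _ (z - crd x *: h) cx; rewrite opprB addrA subrK; apply.
  exists (crd x); last by rewrite subrK.
  move: (n.+1%:R^-1) (node R n i) nx => q v; rewrite ltr_norml => /andP[? ?].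
  by apply/andP; split; lra.
have bG := bddm_dstar h hh GO.
pose W := (\int[gamma]_(x in O) (f x * dstar h hh G x)%:E)%E.
have WV : (W <= Vgamma gamma h hh f O)%E by apply: ereal_sup_ubound; exists G => //; split.
have Ic i : P2.-integrable setT (fun y => (coeff n i y * chi i y)%:E).
  by apply: integrable_bddm; [exact: integrable_coeff|apply: (cutoff_bddm (E := window n i)); have [] := Hchi i].
(* Translation along h moves only the tents, not the cutoffs. *)
have dstarG y t : hh y = 0 -> ~ range (ratr : rat -> R) t ->
  dstar h hh G (recombine h (t, y)) = \sum_(i < nodes n) chi i y * tent_div (hh h) n i t.
  move=> hy it.
  have crdE s : crd (y + s *: h) = s by rewrite /crd dualDr dualZr hy add0r mulfK// gt_eqF.
  have GE : (fun s : R => G (y + s *: h) : R^o) = (fun s => \sum_(i < nodes n) chi i y * tent n i s).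
    apply/funext => s; apply: eq_bigr => i _.
    by rewrite /proj_h -/(crd _) crdE addrK.
  rewrite /dstar /recombine /= -(derive1_section G) GE (derive1_tents (fun i => chi i y) n it).
  have -> : G (y + t *: h) = \sum_(i < nodes n) chi i y * tent n i t by have := congr1 (@^~ t) GE.
  rewrite dualDr dualZr hy add0r mulr_suml -sumrB; apply: eq_bigr => i _.
  rewrite /tent_div; ring.
have WE : W = (\sum_(i < nodes n) \int[P2]_y (coeff n i y * chi i y)%:E)%E.
  rewrite -integral_sum//.
  rewrite /W (gaussian_fubini_weighted sepX gaussX ndQ hQ h0 openO intf bG).
  apply: ae_eq_integral => //.
  - exact: (measurable_fubini_G (gaussian_integrable sepX gaussX ndQ hQ h0
      (integrable_bddm (integrable_restrict_open openO intf) bG))).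
  - by apply: emeasurable_sum => i; exact: (measurable_int _ (Ic i)).
  apply: filterS good_ae => y gy _; have [hy Iy] := gy.
  transitivity (\int[P1]_t (F (t, y) * \sum_(i < nodes n) chi i y * tent_div (hh h) n i t)%:E)%E.
    apply: ae_eq_integral => //.
    + apply: (measurable_int P1); apply: integrable_bddm; first exact: Iy.
      apply: (bddm_comp bG (g := fun t => recombine h (t, y))).
      exact: measurableT_comp (measurable_recombine sepX h) (pair2_measurable y).
    + have mF := measurable_int _ Iy.
      apply/measurable_EFinP; apply: measurable_funM; first exact/measurable_EFinP.
      apply: measurable_sum => i; apply: measurable_funM => //.
      by have [] := bddm_tent_div (hh h) n i.
    have irr := law_coord_ae gaussX ndQ hQ h0 (@ae_irrational R).
    by apply: filterS irr => t it _; rewrite dstarG.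
  rewrite (integral_tents n (fun i => chi i y) gy) -sumEFin.
  by apply: eq_bigr => i _; rewrite mulrC.
apply: (@le_trans _ _ (W + e%:E)%E); last exact: leeD.
under eq_integral do rewrite /sections_sum -sumEFin.
rewrite integral_sum//.
rewrite WE (_ : e = \sum_(i < nodes n) e1); last first.
  by rewrite sumr_const card_ord -[RHS]mulr_natr /e1 divfK ?pnatr_eq0.
rewrite -sumEFin -big_split/=; apply: lee_sum => i _.
by have [] := Hchi i.
Unshelve. all: by end_near. Qed.

(** Fatou's lemma applied to sections_sum. The lines on which the section of f is not integrable form a null
    set, where the measurable majorant is set to infinity. *)
Lemma sections_le_variation :
  (\int[P2]_(y in [set y : X | hh y = 0%R]) Vgamma1 P1 (hh h)^-1
     (section_fun f h y) (section_set O h y) <= Vgamma gamma h hh f O)%E.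
Proof.
have [A [mA A0 gA]] := good_ae.
pose S y := limn_einf (fun n => (sections_sum n y)%:E).
have mS : measurable_fun setT S by apply: measurable_limn_einf => n; exact: measurable_sections_sum.
have S0 y : (0 <= S y)%E.
  apply: (@le_limn_einf _ (cst 0%E)); first exact: cvg_cst.
  by apply: nearW => n; rewrite lee_fin sections_sum_ge0.
pose H y := if y \in A then +oo%E else S y.
have mH : measurable_fun setT H.
  apply: measurable_fun_ifT => //.
  apply: (measurable_fun_bool true); rewrite setTI (_ : _ @^-1` _ = A)//.
  by apply/seteqP; split => x /=; [move/set_mem|move/mem_set].
have H0 y : (0 <= H y)%E by rewrite /H; case: ifP.
apply: (@le_trans _ _ (\int[P2]_y H y)%E).
  rewrite integral_mkcond; apply: ge0_le_lower_integral => y _.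
    by rewrite patchE; case: ifP => // _; exact: Vgamma1_ge0.
  rewrite patchE; case: ifP => // _; rewrite /H.
  have [yA|yA] := boolP (y \in A); first by rewrite leey.
  apply: Vgamma1_le_liminf; apply: contrapT => ngy.
  by move/negP: yA; apply; apply: mem_set; exact: gA.
rewrite (_ : integral _ _ _ = \int[P2]_y S y)%E; last first.
  apply: ge0_ae_eq_integral => //.
  by exists A; split => // y /=; apply: contra_notP => yA _; rewrite /H memNset.
apply: le_trans (fatou _ _ _ _) _ => //.
- by move=> n; exact: measurable_sections_sum.
- by move=> n y _; rewrite /= lee_fin sections_sum_ge0.
by apply: limn_einf_le_ub => n; exact: sections_sum_le_variation.
Qed.

End lower_bound.

Theorem proposition4p2 (R : realType) (X : completeNormedModType R)
    (sepX : separable_space X)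
    (gamma : probability (borel X) R) (Q : {linear dual X -> X})
    (gaussX : centred_gaussian gamma Q) (ndQ : nondegenerate_cov Q)
    (O : set X) (openO : open O)
    (f : X -> R) (fL : L_logL_half gamma O f)
    (h : X) (hh : dual X) (hQ : h = Q hh) (h0 : h != 0) :
  Vgamma gamma h hh f O =
  (\int[gamma_perp gamma h hh]_(y in [set y : X | hh y = 0%R])
     Vgamma1 (gamma1 gamma h hh) (hh h)^-1
       (section_fun f h y) (section_set O h y))%E.
Proof.
have [intf _] := fL; apply/eqP; rewrite eq_le; apply/andP; split.
  apply: ge_ereal_sup => _ [G [GO G1] <-].
  exact: (variation_le_sections sepX gaussX ndQ hQ h0 openO intf GO G1).
exact: (sections_le_variation sepX gaussX ndQ hQ h0 openO intf).
Qed.
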